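(* Suppose $E\subseteq\mathbb{R}^{n+1}$ is $(c,\delta,\theta)$-weakly porous for some $c,\delta\in(0,1)$ and $\theta>1$. Then for every $\psi>1$ there exists $0<\sigma<1$ such that for any parabolic rectangle $R(\gamma_0)\subseteq\mathbb{R}^{n+1}$ with $0\le\gamma_0\le1/2$ and any $P(\gamma)\in\mathcal{D}_1(R(\gamma_0))$ there exist pairwise disjoint $E$-free rectangles $S_1,\dots,S_N\in\mathcal{D}(P(\gamma))$ such that $$|S_i|\ge\sigma\,|\mathcal{M}(R^\psi(\gamma_0))|\quad\text{for each } i=1,\dots,N,\qquad\text{and}\qquad \sum_{i=1}^N|S_i|\ge c\,|P(\gamma)|.$$ In particular, given any $0<c_0<1$ and $1<\theta_1\le\theta_2<\infty$, if $c\ge c_0$ and $\psi\in[\theta_1,\theta_2]$, then one can take $\sigma=C\delta^\nu$ with constants $C=C(n,p,d,c_0,\theta,\theta_1,\theta_2)>0$ and $\nu=\nu(n,p,d,c_0,\theta,\theta_1,\theta_2)>0$.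
   Context: Throughout, $n\ge 1$ is an integer, $1<p<\infty$, and $d\ge1$ is a fixed integer with $dp\ge\log_2 9$. Points of $\mathbb{R}^{n+1}$ are written $(x,t)$ with $x\in\mathbb{R}^n$, $t\in\mathbb{R}$; $|\cdot|$ is Lebesgue measure. Parabolic rectangles: for $x\in\mathbb{R}^n$, $t\in\mathbb{R}$, $L>0$, $0\le\gamma\le1/2$, let $Q(x,L)=\prod_{i}[x_i-L/2,x_i+L/2)$ and $R(\gamma)=R(x,t,L,\gamma)=Q(x,L)\times[t-L^p,t-\gamma L^p)$. Side lengths: $l_x(R(\gamma))=L$, $l_t(R(\gamma))=(1-\gamma)L^p$. For $\theta\in\mathbb{R}$, $R^\theta(\gamma)=R(\gamma)+(0,\theta\, l_t(R(\gamma)))$. Dyadic lattice: $\mathcal{D}_1(R(\gamma))$ is the partition of $R(\gamma)$ obtained by dividing each spatial edge into $2^d$ equal half-open intervals and the temporal edge into $k$ equal half-open intervals, where $k=\lceil 2^{dp}\rceil$ if $0\le\gamma\le 1-\frac{2^{dp}+1}{2^{dp+1}}$ and $k=\lfloor2^{dp}\rfloor$ if $1-\frac{2^{dp}+1}{2^{dp+1}}<\gamma\le\frac12$. Its members are again parabolic rectangles with truncation parameter in $[0,1/2]$. Put $\mathcal{D}_0(R(\gamma))=\{R(\gamma)\}$, $\mathcal{D}_{i+1}(R(\gamma))=\bigcup_{P\in\mathcal{D}_i(R(\gamma))}\mathcal{D}_1(P)$, $\mathcal{D}(R(\gamma))=\bigcup_{i\ge0}\mathcal{D}_i(R(\gamma))$.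 Weak porosity: for a nonempty closed $E$, a set $A$ is $E$-free if $A\cap E=\emptyset$. $\mathcal{F}(R(\gamma_0))$ is the collection of maximal (with respect to inclusion) $E$-free members of $\mathcal{D}(R(\gamma_0))$, and $\mathcal{M}(R(\gamma_0))\in\mathcal{F}(R(\gamma_0))$ is a member with largest $l_x$ ($\mathcal{M}(R(\gamma_0))=\emptyset$ if $\mathcal{F}(R(\gamma_0))=\emptyset$). For $c,\delta\in(0,1)$, $\theta\in\mathbb{R}$, a nonempty closed set $E$ is $(c,\delta,\theta)$-weakly porous if for every parabolic rectangle $R(\gamma_0)$ with $0\le\gamma_0\le1/2$ there are finitely many pairwise disjoint $E$-free $P_1,\dots,P_N\in\mathcal{D}(R(\gamma_0))$ with $|P_k|\ge\delta|\mathcal{M}(R^\theta(\gamma_0))|$ for all $k$ and $\sum_{k=1}^N|P_k|\ge c|R(\gamma_0)|$. *)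

(* Defs.v *)
From HB Require Import structures.
From mathcomp Require Import all_boot all_order all_algebra.
From mathcomp Require Import all_classical all_reals all_analysis.
Set Implicit Arguments.
Unset Strict Implicit.
Unset Printing Implicit Defensive.
Import Order.TTheory GRing.Theory Num.Theory.
Import numFieldNormedType.Exports.
Local Open Scope classical_set_scope.
Local Open Scope ring_scope.

(* A point (x, t) of R^{n+1}, with x in R^n and t in R. *)
Notation spacetime R n := ('rV[R]_n * R)%type.

(* Lebesgue measure as the product of one-dimensional Lebesgue measures: as in
   the library's product_measure1, the measure of a set is the integral of the
   measure of its sections.  This is Lebesgue measure on Borel sets; below it
   is applied only to half-open boxes and to the empty set. *)
Fixpoint lebesgue_rV (R : realType) (n : nat) : set 'rV[R]_n -> \bar R :=
  match n with
  | 0 => fun A => (\1_A (0 : 'rV[R]_0))%:E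
  | m.+1 => fun A : set 'rV[R]_(1 + m) =>
      (\int[@lebesgue_measure R]_x
         @lebesgue_rV R m [set v | row_mx x%:M v \in A])%E
  end.

Definition lebesgue_pt (R : realType) (n : nat) (A : set (spacetime R n)) : \bar R :=
  (\int[@lebesgue_measure R]_t lebesgue_rV [set x | (x, t) \in A])%E.

(* The parameters (x, t, L, gamma) of a parabolic rectangle.  For n >= 1 and
   L > 0 they are determined by the underlying set prect_set, so that families
   of rectangles can be handled as families of parameters. *)
Record prect (R : realType) (n : nat) := PRect {
  px : 'rV[R]_n;
  pt : R;
  plx : R;
  pgamma : R }.

Section ParabolicRectangles.
Context {R : realType} {n : nat}.
Variables (p : R) (d : nat).
Implicit Types (P Q : prect R n) (E : set (spacetime R n)).

Definition is_prect P : Prop := 0 < plx P /\ 0 <= pgamma P <= 1 / 2.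

Definition plt P : R := (1 - pgamma P) * plx P `^ p.

Definition pleft P (i : 'I_n) : R := px P ord0 i - plx P / 2.
Definition pbottom P : R := pt P - plx P `^ p.

Definition prect_set P : set (spacetime R n) :=
  [set z : spacetime R n | (forall i : 'I_n, pleft P i <= z.1 ord0 i < px P ord0 i + plx P / 2)
         /\ pbottom P <= z.2 < pt P - pgamma P * plx P `^ p].

Definition pmeas P : \bar R := lebesgue_pt (prect_set P).

Definition pshift (theta : R) P : prect R n :=
  PRect (px P) (pt P + theta * plt P) (plx P) (pgamma P).

Definition dyadic_k (gamma : R) : nat :=
  if gamma <= 1 - (2 `^ (d%:R * p) + 1) / 2 `^ (d%:R * p + 1)
  then `|Num.ceil (2 `^ (d%:R * p) : R)|%N
  else `|Num.floor (2 `^ (d%:R * p) : R)|%N.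

(* Q is the cell of P with index (j, m) in the subdivision.  The edge lengths
   and the lower corner determine all the parameters of Q. *)
Definition dyadic1 P : set (prect R n) :=
  [set Q | [/\ plx Q = plx P / 2 ^+ d,
               plt Q = plt P / (dyadic_k (pgamma P))%:R &
               exists (j : 'I_n -> 'I_(2 ^ d)) (m : 'I_(dyadic_k (pgamma P))),
                 (forall i, pleft Q i = pleft P i + (j i)%:R * plx Q)
                 /\ pbottom Q = pbottom P + m%:R * plt Q]].

Fixpoint dyadic_gen (i : nat) P : set (prect R n) :=
  match i with
  | 0 => [set P]
  | i'.+1 => \bigcup_(Q in dyadic_gen i' P) dyadic1 Q
  end.

Definition dyadic P : set (prect R n) := \bigcup_i dyadic_gen i P.

Definition set_free E (A : set (spacetime R n)) : Prop := A `&` E = set0.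

Definition maximal_free E P : set (prect R n) :=
  [set Q | [/\ dyadic P Q, set_free E (prect_set Q) &
     forall Q', dyadic P Q' -> set_free E (prect_set Q') ->
       prect_set Q `<=` prect_set Q' -> prect_set Q' = prect_set Q]].

(* xget makes a choice among the members of largest l_x, and returns set0 when
   there is none.  Those members belong to one generation, so the measure of
   the result does not depend on the choice. *)
Definition largest_free E P : set (spacetime R n) :=
  xget set0 [set prect_set Q | Q in
    [set Q | maximal_free E P Q /\
             forall Q', maximal_free E P Q' -> plx Q' <= plx Q]].

Definition disjoint_free E P (N : nat) (S : 'I_N -> prect R n) : Prop :=
  [/\ forall i, dyadic P (S i), forall i, set_free E (prect_set (S i)) &
      forall i j, i != j -> prect_set (S i) `&` prect_set (S j) = set0].

Definition weakly_porous (c delta theta : R) E : Prop :=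
  [/\ 0 < c < 1, 0 < delta < 1, E !=set0, closed E &
  forall P, is_prect P ->
    exists (N : nat) (S : 'I_N -> prect R n),
      [/\ disjoint_free E P S,
          forall k, (delta%:E * lebesgue_pt (largest_free E (pshift theta P))
                     <= pmeas (S k))%E &
          (c%:E * pmeas P <= \sum_(k < N) pmeas (S k))%E]].

Definition dyadic_child_porous (c sigma psi : R) E : Prop :=
  forall P0 P, is_prect P0 -> dyadic1 P0 P ->
    exists (N : nat) (S : 'I_N -> prect R n),
      [/\ disjoint_free E P S,
          forall i, (sigma%:E * lebesgue_pt (largest_free E (pshift psi P0))
                     <= pmeas (S i))%E &
          (c%:E * pmeas P <= \sum_(i < N) pmeas (S i))%E].

End ParabolicRectangles.

(* Main.v *)
(** Applying weak porosity to a parabolic cube [Q'] next to a cube [Q] of the same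
size, the free rectangles cover a fixed fraction of [Q'], so one of them keeps
half of its volume inside [Q]: the free size of [Q] is, up to a factor
proportional to [delta], at least that of [Q'] moved forward in time by [theta].
Repeating this, one travels from [P] towards [R^psi], and since [p > 1], small
enough cubes can move a distance [L] in space within a time much shorter than
[(psi - 1) L^p].  Hence [P] is first subdivided into tiny dyadic cells, from each
of which a bounded number of steps leads to the largest free rectangle of
[R^psi]; the porous families of the cells are then united. *)
Require Import Defs.
From mathcomp Require Import all_boot all_order all_algebra.
From mathcomp Require Import all_classical all_reals all_analysis.
From mathcomp Require Import ring lra.
Set Implicit Arguments.
Unset Strict Implicit.
Unset Printing Implicit Defensive.
Import Order.TTheory GRing.Theory Num.Theory.
Import numFieldNormedType.Exports.
Local Open Scope classical_set_scope.
Local Open Scope ring_scope.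

(** * Volumes of boxes *)

(** Porosity at a rectangle sees only its translate by exactly [theta] time lengths, while [psi] may
    lie below or far above [theta]. For cubes of side l much smaller than L a step in time, theta
    l^p, is short, and the slack of each step, eta l in space and eta l^p in time, accumulates: K
    steps realize every time displacement within K eta l^p of K theta l^p, so from K >= theta/eta on
    these ranges leave no gap. In units of l, the distance in space is at most r = L/l and asks for
    K >= r/eta; in units of l^p, the available time is of order r^p. Taking r large is where p > 1
    decides. The number of steps is then bounded in terms of r, p and [theta2], whence a fixed power
    of [delta]. The chain costs only size, never mass: [c] comes from one last application of
    porosity, to the tiny cell itself, and it survives the union because the cells tile [P]. *)

Lemma mem_itv_co (R : realType) (a b y : R) :
  (y \in `[a, b[%classic) = (a <= y < b).
Proof. by apply/idP/idP; rewrite inE /= in_itv. Qed.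

Lemma integral_indic_itv (R : realType) (a b : R) :
  (\int[@lebesgue_measure R]_y (\1_`[a, b[%classic y)%:E = (Num.max 0 (b - a))%:E)%E.
Proof.
rewrite integral_indic //= setIT lebesgue_measure_itv /= lte_fin.
case: ltP => ab; first by rewrite -EFinB max_r // subr_ge0 ltW.
by rewrite max_l // subr_le0.
Qed.

(** Integration of the pointwise inequality. This is the one-dimensional case, used for one
    coordinate at a time in [box_comb]. *)
Lemma interval_comb (R : realType) (I : finType) (c a b : I -> R) :
  (forall y, 0 <= \sum_k c k * (a k <= y < b k)%R%:R) ->
  0 <= \sum_k c k * Num.max 0 (b k - a k).
Proof.
move=> H.
have : (0 <= \int[@lebesgue_measure R]_y
   (\sum_k ((c k)%:E * (\1_`[a k, b k[%classic y)%:E)))%E.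
  apply: integral_ge0 => y _.
  rewrite (eq_bigr (fun k => (c k * (a k <= y < b k)%R%:R)%:E)) => [|k _].
    by rewrite sumEFin lee_fin.
  by rewrite -EFinM indicE mem_itv_co.
rewrite integral_sum //; last first.
  by move=> k; apply: integrableZl => //; exact: integrable_indic_itv.
rewrite (eq_bigr (fun k => (c k * Num.max 0 (b k - a k))%:E)) => [|k _].
  by rewrite sumEFin lee_fin.
rewrite integralZl //; last exact: integrable_indic_itv.
by rewrite integral_indic_itv.
Qed.

(** Corners and points are infinite sequences of which only the first [m] entries are read, so that
    induction on the dimension needs no casts. *)
Definition in_box (R : realType) (m : nat) (a b y : nat -> R) : bool :=
  [forall i : 'I_m, a i <= y i < b i].

(** Truncation at 0 makes the product right for empty boxes, which arise below as intersections. *)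
Definition box_vol (R : realType) (m : nat) (a b : nat -> R) : R :=
  \prod_(i < m) Num.max 0 (b i - a i).

Lemma in_boxS (R : realType) (m : nat) (a b y : nat -> R) :
  in_box m.+1 a b y = in_box m a b y && (a m <= y m < b m).
Proof.
apply/forallP/andP => [H | [/forallP H1 H2] i].
  split; last exact: (H ord_max).
  by apply/forallP => i; exact: (H (widen_ord (leqnSn m) i)).
case: (unliftP ord_max i) => [j ->|-> //].
by have := H1 j; rewrite lift_max.
Qed.

(* The signs of the coefficients are arbitrary, so that inclusion-exclusion
   inequalities between indicators can be integrated. *)
Lemma box_comb (R : realType) (m : nat) (I : finType) (c : I -> R)
    (a b : I -> nat -> R) :
  (forall y, 0 <= \sum_k c k * (in_box m (a k) (b k) y)%:R) ->
  0 <= \sum_k c k * box_vol m (a k) (b k).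
Proof.
elim: m c => [|m IH] c H.
  have := H (fun=> 0); congr (_ <= _); apply: eq_bigr => k _.
  rewrite /box_vol big_ord0 (_ : in_box _ _ _ _ = true) //.
  by apply/forallP => -[].
(* The last coordinate is integrated out first: its lengths are absorbed into the coefficients, to
   which the induction hypothesis is then applied. *)
have -> : \sum_k c k * box_vol m.+1 (a k) (b k) =
    \sum_k (c k * Num.max 0 (b k m - a k m)) * box_vol m (a k) (b k).
  by apply: eq_bigr => k _; rewrite /box_vol big_ord_recr /= -mulrA [X in _ * X]mulrC.
apply: IH => y.
have := @interval_comb R I (fun k => c k * (in_box m (a k) (b k) y)%:R)
  (fun k => a k m) (fun k => b k m).
under eq_bigr do rewrite mulrAC.
apply => y0.
have := H (fun i => if i == m then y0 else y i).
congr (_ <= _); apply: eq_bigr => k _.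
rewrite -mulrA -natrM mulnb in_boxS eqxx; congr (_ * (_ && _)%:R).
by apply: eq_forallb => i; rewrite ltn_eqF.
Qed.

Lemma lebesgue_rV0 (R : realType) (n : nat) : @lebesgue_rV R n set0 = 0%E.
Proof.
elim: n => [|n IH] /=; first by rewrite indicE in_set0.
transitivity (\int[@lebesgue_measure R]_(x in setT) 0%E)%E; last exact: integral0.
apply: eq_integral => x _.
by rewrite (_ : [set _ | _] = set0) //; apply/seteqP; split => v //=; rewrite in_set0.
Qed.

Lemma integral_step (R : realType) (a l c : R) : 0 <= l ->
  (\int[@lebesgue_measure R]_y (if (a <= y < a + l)%R then c%:E else 0) = (l * c)%:E)%E.
Proof.
move=> l0.
transitivity (\int[@lebesgue_measure R]_y (c%:E * (\1_`[a, (a + l)[%classic y)%:E))%E.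
  apply: eq_integral => y _; rewrite indicE mem_itv_co.
  by case: ifP => _; rewrite ?mule1 ?mule0.
rewrite integralZl //; last exact: integrable_indic_itv.
by rewrite integral_indic_itv addrC addKr max_r // mulrC.
Qed.

Lemma lebesgue_rV_box (R : realType) (n : nat) (a : 'I_n -> R) (l : R) :
  0 <= l ->
  lebesgue_rV [set v : 'rV[R]_n | forall i, a i <= v ord0 i < a i + l]
  = (l ^+ n)%:E.
Proof.
move=> l0; elim: n a => [|n IH] a.
  by rewrite /= indicE mem_set // => -[].
rewrite /= exprS -(integral_step (a ord0)) //.
apply: eq_integral => y _; case: ifP => yl.
  rewrite -(IH (fun i => a (lift ord0 i))); congr lebesgue_rV.
  apply/seteqP; split => v /=; rewrite in_setE /=.
    move=> H i; have := H (rshift 1 i); rewrite (@row_mxEr _ 1 1 n).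
    by rewrite (_ : rshift 1 i = lift ord0 i) //; apply: val_inj.
  move=> H i; case: (@split_ordP 1 n i) => j ->.
    by rewrite (@row_mxEl _ 1 1 n) (ord1 j) mxE eqxx mulr1n
      (_ : lshift n 0 = ord0) //; apply: val_inj.
  rewrite (@row_mxEr _ 1 1 n) (_ : rshift 1 j = lift ord0 j) //.
  exact: val_inj.
rewrite (_ : [set _ | _] = set0) ?lebesgue_rV0 //.
apply/seteqP; split => v //=; rewrite in_setE /= => /(_ (@lshift 1 n ord0)).
rewrite (@row_mxEl _ 1 1 n) mxE eqxx mulr1n (_ : @lshift 1 n ord0 = ord0) ?yl //.
exact: val_inj.
Qed.

(** * Overlap of disjoint families of boxes *)

Section BoxFamilies.
Variables (R : realType) (m : nat).
Implicit Types (a b y : nat -> R).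

Definition maxf a a' (i : nat) : R := Num.max (a i) (a' i).
Definition minf b b' (i : nat) : R := Num.min (b i) (b' i).

Lemma in_boxI a b a' b' y :
  in_box m (maxf a a') (minf b b') y = in_box m a b y && in_box m a' b' y.
Proof.
apply/forallP/andP => [H | [/forallP H1 /forallP H2] i].
  by split; apply/forallP => i; have := H i; rewrite /maxf /minf ge_max lt_min;
    case/andP => /andP[? ?] /andP[? ?]; apply/andP.
have /andP[h1 h2] := H1 i; have /andP[h3 h4] := H2 i.
by rewrite /maxf /minf ge_max lt_min h1 h2 h3 h4.
Qed.

Lemma sum_in_box_le1 (I : finType) (a b : I -> nat -> R) a' b' y :
  (forall k, in_box m (a k) (b k) y -> in_box m a' b' y) ->
  (forall k k', in_box m (a k) (b k) y -> in_box m (a k') (b k') y -> k = k') ->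
  \sum_k (in_box m (a k) (b k) y)%:R <= (in_box m a' b' y)%:R :> R.
Proof.
move=> sub disj.
have [/existsP[k hk]|/existsPn H] := boolP [exists k, in_box m (a k) (b k) y].
  rewrite (bigD1 k) //= hk (sub k hk) big1 ?addr0 // => k' kk'.
  case: (boolP (in_box _ _ _ _)) => // hk'.
  by rewrite (disj _ _ hk hk') eqxx in kk'.
by rewrite big1 ?ler0n // => k _; rewrite (negbTE (H k)).
Qed.

(** Pointwise this is (1' - sum_k 1_k)(1 - 1_0) >= 0: the part of the family outside the box [a0],
    [b0] lies in the part of the box [a'], [b'] outside it. *)
Lemma box_vol_overlap (I : finType) (a b : I -> nat -> R) a' b' a0 b0 :
  (forall k y, in_box m (a k) (b k) y -> in_box m a' b' y) ->
  (forall k k' y, in_box m (a k) (b k) y -> in_box m (a k') (b k') y -> k = k') ->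
  \sum_k box_vol m (a k) (b k) - box_vol m a' b' +
    box_vol m (maxf a' a0) (minf b' b0) <=
  \sum_k box_vol m (maxf (a k) a0) (minf (b k) b0).
Proof.
move=> sub disj.
pose J := (I + I + bool)%type.
pose c (j : J) : R := match j with
  | inl (inl _) => -1 | inl (inr _) => 1 | inr true => 1 | inr false => -1 end.
pose A (j : J) := match j with
  | inl (inl k) => a k | inl (inr k) => maxf (a k) a0
  | inr true => a' | inr false => maxf a' a0 end.
pose B (j : J) := match j with
  | inl (inl k) => b k | inl (inr k) => minf (b k) b0
  | inr true => b' | inr false => minf b' b0 end.
(* Stated for an arbitrary [F], to serve both for volumes and for indicators at a point. *)
have sumE (F : (nat -> R) -> (nat -> R) -> R) : \sum_j c j * F (A j) (B j) =
    F a' b' - F (maxf a' a0) (minf b' b0)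
    - (\sum_k F (a k) (b k) - \sum_k F (maxf (a k) a0) (minf (b k) b0)).
  rewrite !big_sumType big_bool /= !mul1r mulN1r addrC opprB; congr (_ + _).
  rewrite addrC; congr (_ + _); first by apply: eq_bigr => k _; rewrite mul1r.
  by rewrite -sumrN; apply: eq_bigr => k _; rewrite mulN1r.
have := @box_comb R m J c A B; rewrite sumE => H.
suff /H : forall y, 0 <= \sum_k c k * (in_box m (A k) (B k) y)%:R by lra.
move=> y; rewrite (sumE (fun a b => (in_box m a b y)%:R)).
have := sum_in_box_le1 (fun k => @sub k y) (fun k k' => @disj k k' y).
rewrite (eq_bigr (fun k => (in_box m (a k) (b k) y)%:R *
  (in_box m a0 b0 y)%:R) (F1 := fun k => (in_box m (maxf _ _) _ _)%:R)) => [|k _].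
  rewrite -mulr_suml in_boxI.
  case: (in_box m a0 b0 y); rewrite ?andbT ?andbF /= ?mulr1 ?mulr0; lra.
by rewrite in_boxI -mulnb natrM.
Qed.

(** The large box loses at most the fraction c/2 of its volume, hence at most half of the total
    volume of the family; so the members cannot all lose more than half of theirs. *)
Lemma exists_half_overlap (I : finType) (a b : I -> nat -> R) a' b' a0 b0 (c : R) :
  0 < c -> 0 < box_vol m a' b' ->
  (forall k y, in_box m (a k) (b k) y -> in_box m a' b' y) ->
  (forall k k' y, in_box m (a k) (b k) y -> in_box m (a k') (b k') y -> k = k') ->
  c * box_vol m a' b' <= \sum_k box_vol m (a k) (b k) ->
  (1 - c / 2) * box_vol m a' b' <= box_vol m (maxf a' a0) (minf b' b0) ->
  exists k, box_vol m (a k) (b k) / 2 <= box_vol m (maxf (a k) a0) (minf (b k) b0).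
Proof.
move=> c0 v0 sub disj hc hq; apply: contrapT => /forallNP H.
have S0 : 0 < \sum_k box_vol m (a k) (b k).
  by apply: lt_le_trans hc; rewrite mulr_gt0.
have := @box_vol_overlap I a b a' b' a0 b0 sub disj.
suff : \sum_k box_vol m (maxf (a k) a0) (minf (b k) b0) <
    (\sum_k box_vol m (a k) (b k)) / 2 by nra.
rewrite mulr_suml; apply: ltr_sum => [|k _]; last by rewrite ltNge; apply/negP.
apply/hasP; apply: contrapT => nk; move: S0; rewrite big1 ?ltxx // => k _.
by exfalso; apply: nk; exists k; rewrite ?mem_index_enum.
Qed.

(** The other factors only shrink, so one factor alone cannot lose more than the whole product does.
    This turns half of a volume into half of every side. *)
Lemma prod_half (f g : 'I_m -> R) i :
  (forall i, 0 <= f i <= g i) -> 0 < \prod_i g i ->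
  (\prod_i g i) / 2 <= \prod_i f i -> g i / 2 <= f i.
Proof.
move=> fg; rewrite (bigD1 i) //= [X in _ -> _ <= X -> _](bigD1 i) //=.
set G := \prod_(_ | _) _; set F := \prod_(_ | _) _.
have gi : 0 <= g i by have /andP[] := fg i; exact: le_trans.
have G0 : 0 <= G by apply: prodr_ge0 => j _; have /andP[] := fg j; exact: le_trans.
have FG : F <= G by apply: ler_prod => j _; exact: fg.
have /andP[f0 _] := fg i => gG H.
have {}G0 : 0 < G by rewrite lt_neqAle G0 andbT; apply: contraTneq gG => <-; rewrite mulr0 ltxx.
rewrite -(ler_pM2r G0).
by apply: le_trans (ler_wpM2l f0 FG); rewrite mulrAC.
Qed.

End BoxFamilies.

(** * Boxes in space-time *)

Section RectangleBoxes.
Variables (R : realType) (n : nat).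

Definition rbox (a : 'I_n -> R) (b l t : R) : set (spacetime R n) :=
  [set z : spacetime R n | (forall i, a i <= z.1 ord0 i < a i + l) /\ b <= z.2 < b + t].

Lemma lebesgue_pt_rbox a b (l t : R) : 0 <= l -> 0 <= t ->
  Defs.lebesgue_pt (rbox a b l t) = (l ^+ n * t)%:E.
Proof.
move=> l0 t0; rewrite /Defs.lebesgue_pt mulrC -(integral_step b) //.
apply: eq_integral => y _; case: ifP => yl.
  rewrite -(lebesgue_rV_box a) //; congr lebesgue_rV.
  by apply/seteqP; split => v /=; rewrite in_setE /rbox /= yl; [case | split].
rewrite (_ : [set _ | _] = set0) ?lebesgue_rV0 //.
by apply/seteqP; split => v //=; rewrite in_setE /rbox /= yl => -[].
Qed.

Lemma lebesgue_pt0 : Defs.lebesgue_pt (set0 : set (spacetime R n)) = 0%E.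
Proof.
rewrite /Defs.lebesgue_pt.
transitivity (\int[@lebesgue_measure R]_(x in setT) 0%E)%E; last exact: integral0.
apply: eq_integral => x _; rewrite (_ : [set _ | _] = set0) ?lebesgue_rV0 //.
by apply/seteqP; split => v //=; rewrite in_set0.
Qed.

(** Space coordinates first, time as entry [n]: the passage from space-time to the sequences read by
    [in_box]. *)
Definition coord_fun (f : 'I_n -> R) (g : R) (i : nat) : R := oapp f g (insub i).

Lemma coord_fun_lt f g (i : 'I_n) : coord_fun f g i = f i.
Proof. by rewrite /coord_fun valK. Qed.

Lemma coord_fun_last f g : coord_fun f g n = g.
Proof. by rewrite /coord_fun insubF ?ltnn. Qed.

Definition pt_of_coord (y : nat -> R) : spacetime R n := (\row_i y i, y n).

Lemma ord_last_ind (P : 'I_n.+1 -> Prop) :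
  (forall i : 'I_n, P (widen_ord (leqnSn n) i)) -> P ord_max -> forall i, P i.
Proof.
move=> H1 H2 i; case: (unliftP ord_max i) => [j|] -> //.
rewrite (_ : lift _ _ = widen_ord (leqnSn n) j) //.
by apply: val_inj; rewrite /= /bump leqNgt ltn_ord.
Qed.

Lemma in_box_rbox a b (l t : R) y :
  reflect (rbox a b l t (pt_of_coord y))
    (in_box n.+1 (coord_fun a b) (coord_fun (fun i => a i + l) (b + t)) y).
Proof.
rewrite in_boxS !coord_fun_last; apply: (iffP andP) => -[H1 H2]; split => //.
  move=> i /=; rewrite mxE; have /forallP/(_ i) := H1.
  by rewrite !coord_fun_lt.
by apply/forallP => i; have := H1 i; rewrite !coord_fun_lt mxE.
Qed.

Lemma box_vol_rbox a b (l t : R) : 0 <= l -> 0 <= t ->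
  box_vol n.+1 (coord_fun a b) (coord_fun (fun i => a i + l) (b + t)) = l ^+ n * t.
Proof.
move=> l0 t0; rewrite /box_vol big_ord_recr /= !coord_fun_last [b + t - b]addrC addKr.
rewrite [Num.max 0 t]max_r //; congr (_ * _).
rewrite (eq_bigr (fun=> l)) ?prodr_const ?card_ord // => i _.
by rewrite !coord_fun_lt [a i + l - a i]addrC addKr max_r.
Qed.

(** Moving a box by at most the fraction [eta] of each side keeps the fraction (1 - eta)^(n+1) of
    its volume. A member that keeps half of its volume keeps half of each side, and an intersection
    of boxes is a box, so it contains a box with halved sides. *)
Lemma rbox_half_overlap (I : finType) (sa : I -> 'I_n -> R) (sb sl st : I -> R)
    a' b' a b (l t eta c : R) :
  (forall k, 0 < sl k) -> (forall k, 0 < st k) ->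
  0 < l -> 0 < t -> 0 < c -> 0 <= eta <= 1 ->
  1 - c / 2 <= (1 - eta) ^+ n.+1 ->
  (forall i, `|a i - a' i| <= eta * l) -> `|b - b'| <= eta * t ->
  (forall k, rbox (sa k) (sb k) (sl k) (st k) `<=` rbox a' b' l t) ->
  (forall k k', k != k' -> rbox (sa k) (sb k) (sl k) (st k) `&`
     rbox (sa k') (sb k') (sl k') (st k') = set0) ->
  c * (l ^+ n * t) <= \sum_k sl k ^+ n * st k ->
  exists k y u, rbox y u (sl k / 2) (st k / 2) `<=`
    rbox (sa k) (sb k) (sl k) (st k) `&` rbox a b l t.
Proof.
move=> sl0 st0 l0 t0 c0 eta01 hc ha hb sub disj hS.
have l0' := ltW l0; have t0' := ltW t0.
have sl0' k := ltW (sl0 k); have st0' k := ltW (st0 k).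
pose A k := coord_fun (sa k) (sb k).
pose B k := coord_fun (fun i => sa k i + sl k) (sb k + st k).
pose A' := coord_fun a' b'.
pose B' := coord_fun (fun i => a' i + l) (b' + t).
pose A0 := coord_fun a b.
pose B0 := coord_fun (fun i => a i + l) (b + t).
have [||k y /in_box_rbox|k k' y /in_box_rbox h1 /in_box_rbox h2|||k hk] :=
  @exists_half_overlap R n.+1 I A B A' B' A0 B0 c.
- exact: c0.
- by rewrite box_vol_rbox // mulr_gt0 ?exprn_gt0.
- by move/sub => h; apply/in_box_rbox.
- have [//|kk'] := eqVneq k k'.
  by have : set0 (pt_of_coord y) by rewrite -(disj _ _ kk').
- rewrite box_vol_rbox //; apply: le_trans hS _; rewrite le_eqVlt.
  by apply/orP; left; apply/eqP/eq_bigr => k _; rewrite box_vol_rbox.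
- have v0 : 0 < l ^+ n * t by rewrite mulr_gt0 ?exprn_gt0.
  rewrite box_vol_rbox //; apply: le_trans (ler_wpM2r (ltW v0) hc) _.
  rewrite exprSr mulrACA -exprMn /box_vol big_ord_recr /=.
  have /andP[eta0 eta1] := eta01.
  have overlap1 (x x' s : R) : 0 < s -> `|x - x'| <= eta * s ->
      (1 - eta) * s <= Num.min (x' + s) (x + s) - Num.max x' x.
    rewrite ler_norml => s0 /andP[h1 h2].
    have [h|h] := leP x' x; first by rewrite min_l ?lerD2r //; lra.
    by rewrite min_r ?lerD2r ?(ltW h) //; lra.
  have eta1' : 0 <= 1 - eta by lra.
  apply: ler_pM.
  + by rewrite exprn_ge0 // mulr_ge0.
  + by rewrite mulr_ge0.
  + rewrite -[X in _ ^+ X](card_ord n) -prodr_const; apply: ler_prod => i _.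
    rewrite mulr_ge0 //= /maxf /minf /A' /B' /A0 /B0. rewrite !coord_fun_lt.
    by rewrite le_max overlap1 ?orbT.
  + by rewrite /maxf /minf /A' /B' /A0 /B0 !coord_fun_last le_max overlap1 ?orbT.
have half i : (B k (i : 'I_n.+1) - A k i) / 2 <=
    Num.min (B k i) (B0 i) - Num.max (A k i) (A0 i) .
  have AB0 (j : 'I_n.+1) : 0 < B k j - A k j.
    move: j; apply: ord_last_ind => [j|]; rewrite /A /B.
      by rewrite !coord_fun_lt addrC addKr.
    by rewrite !coord_fun_last addrC addKr.
  have := @prod_half R n.+1
    (fun i => Num.max 0 (Num.min (B k i) (B0 i) - Num.max (A k i) (A0 i)))
    (fun i => Num.max 0 (B k i - A k i)) i.
  rewrite /= [Num.max 0 (B k i - _)]max_r; last exact: ltW. move=> H.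
  have /orP[|//] : ((B k i - A k i) / 2 <= 0) ||
      ((B k i - A k i) / 2 <= Num.min (B k i) (B0 i) - Num.max (A k i) (A0 i)).
    rewrite -le_max; apply: H => // [j|]; last first.
      by rewrite prodr_gt0 // => j _; rewrite lt_max AB0 orbT.
    rewrite le_max lexx /= ge_max le_max lexx /= le_max.
    by rewrite lerB ?orbT // ?ge_min ?le_max lexx.
  by rewrite leNgt divr_gt0.
(* The witness starts at the lower corner of the intersection. *)
exists k, (fun i => Num.max (sa k i) (a i)), (Num.max (sb k) b) => z [/= z1 z2].
have key (x1 x2 y1 y2 s w : R) : s <= Num.min y1 y2 - Num.max x1 x2 ->
    Num.max x1 x2 <= w < Num.max x1 x2 + s ->
    (x1 <= w < y1) /\ (x2 <= w < y2).
  move=> h1 /andP[h2 h3]; have h4 : w < Num.min y1 y2 by lra.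
  by move: h2 h4; rewrite ge_max lt_min => /andP[-> ->] /andP[-> ->].
have h2 : (sb k <= z.2 < sb k + st k) /\ (b <= z.2 < b + t).
  apply: key z2; have := half ord_max.
  by rewrite /A /B /A0 /B0 !coord_fun_last [sb k + _ - _]addrC addKr.
have h1 i : (sa k i <= z.1 ord0 i < sa k i + sl k) /\ (a i <= z.1 ord0 i < a i + l).
  apply: key (z1 i); have := half (widen_ord (leqnSn n) i).
  by rewrite /A /B /A0 /B0 !coord_fun_lt [sa k i + _ - _]addrC addKr.
by split; split; [move=> i; exact: (h1 i).1 | exact: h2.1 |
  move=> i; exact: (h1 i).2 | exact: h2.2].
Qed.

End RectangleBoxes.

Lemma mul_divK (F : fieldType) (x k : F) : k != 0 -> k * (x / k) = x.
Proof. by move=> k0; rewrite mulrC divfK. Qed.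

(** * Parabolic rectangles and their dyadic lattices *)

Section Rectangles.
Variables (R : realType) (n : nat) (p : R).
Implicit Types (P Q : prect R n).

Lemma rbox_sub a b l t a' b' (l' t' : R) : 0 < l -> 0 < t ->
  @rbox R n a b l t `<=` rbox a' b' l' t' ->
  (forall i, a' i <= a i /\ a i + l <= a' i + l') /\ (b' <= b /\ b + t <= b' + t').
Proof.
move=> l0 t0 sub.
have corner : rbox a b l t (\row_i a i, b).
  by split => [i|] /=; rewrite ?mxE lexx ltrDl.
have [/= c1 c2] := sub _ corner; split => [i|].
  have := c1 i; rewrite mxE => /andP[h1 h2]; split => //; rewrite leNgt; apply/negP => h3.
  (* If the first box stuck out, [y] would be a coordinate of it that is not below the upper end of
     the second box. *)
  pose y := Num.max (a i) (a' i + l').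
  have : rbox a b l t (\row_j (if j == i then y else a j), b).
    split => [j|] /=; rewrite ?mxE ?lexx ?ltrDl //.
    case: eqP => [->|_]; last by rewrite lexx ltrDl.
    by rewrite /y le_max lexx gt_max h3 ltrDl l0.
  move/sub => -[/(_ i) /=]; rewrite mxE eqxx => /andP[_].
  by rewrite /y gt_max ltxx andbF.
case/andP: c2 => h1 h2; split => //; rewrite leNgt; apply/negP => h3.
pose y := Num.max b (b' + t').
have : rbox a b l t (\row_j a j, y).
  split => [j|] /=; first by rewrite mxE lexx ltrDl.
  by rewrite /y le_max lexx gt_max h3 ltrDl t0.
by move/sub => -[_ /=] /andP[_]; rewrite /y gt_max ltxx andbF.
Qed.

Lemma rbox_sub_eq a b a' b' (l t : R) : 0 < l -> 0 < t ->
  @rbox R n a b l t `<=` rbox a' b' l t -> rbox a' b' l t = rbox a b l t.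
Proof.
move=> l0 t0 /(rbox_sub l0 t0) [H1 [h1 h2]].
have -> : a' = a by apply/funext => i; have [h3 h4] := H1 i; lra.
by have -> : b' = b by lra.
Qed.

Lemma rbox_subset a b (l t : R) a' b' (l' t' : R) :
  (forall i, a' i <= a i /\ a i + l <= a' i + l') -> b' <= b -> b + t <= b' + t' ->
  @rbox R n a b l t `<=` rbox a' b' l' t'.
Proof.
move=> H h1 h2 z [z1 z2]; split => [i|].
  by have /andP[u1 u2] := z1 i; have [u3 u4] := H i; apply/andP; split; lra.
by case/andP: z2 => u1 u2; apply/andP; split; lra.
Qed.

Lemma prect_setE P :
  prect_set p P = rbox (pleft P) (pbottom p P) (plx P) (plt p P).
Proof.
have e1 i : pleft P i + plx P = px P ord0 i + plx P / 2 by rewrite /pleft; lra.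
have e2 : pbottom p P + plt p P = pt P - pgamma P * plx P `^ p.
  by rewrite /pbottom /plt; lra.
apply/seteqP; split => z [z1 z2].
  by split => [i|]; [rewrite e1; exact: z1 | rewrite e2].
by split => [i|]; [rewrite -e1; exact: z1 | rewrite -e2].
Qed.

Lemma plx_gt0 P : is_prect P -> 0 < plx P. Proof. by case. Qed.

Lemma plt_bounds P : is_prect P ->
  plx P `^ p / 2 <= plt p P <= plx P `^ p.
Proof.
case=> l0 /andP[g0 g1]; rewrite /plt.
have := powR_gt0 p l0; set w := _ `^ _ => w0.
by apply/andP; split; nra.
Qed.

Lemma plt_gt0 P : is_prect P -> 0 < plt p P.
Proof.
move=> hP; have /andP[h _] := plt_bounds hP.
by apply: lt_le_trans h; rewrite divr_gt0 // powR_gt0 ?plx_gt0.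
Qed.

Lemma pmeasE P : is_prect P -> pmeas p P = (plx P ^+ n * plt p P)%:E.
Proof.
by move=> hP; rewrite /pmeas prect_setE lebesgue_pt_rbox // ltW ?plx_gt0 ?plt_gt0.
Qed.

Lemma pshift_prect theta P : is_prect P -> is_prect (pshift p theta P).
Proof. by []. Qed.

Lemma pshift_plt theta P : plt p (pshift p theta P) = plt p P.
Proof. by []. Qed.

Lemma pshift_bottom theta P :
  pbottom p (pshift p theta P) = pbottom p P + theta * plt p P.
Proof. by rewrite /pbottom /=; lra. Qed.

Lemma cell1_cover (a l y : R) (N : nat) : 0 < l -> a <= y < a + N%:R * l ->
  exists j : 'I_N, a + j%:R * l <= y < a + j%:R * l + l.
Proof.
move=> l0 /andP[h1 h2].
have q0 : 0 <= (y - a) / l by rewrite divr_ge0 ?subr_ge0 // ltW.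
have /andP[] := truncn_itv q0; set j := Num.truncn _.
rewrite ler_pdivlMr // ltr_pdivrMr // -natr1 mulrDl mul1r => h3 h4.
have jN : (j < N)%N by rewrite -(ltr_nat R) -(ltr_pM2r l0); lra.
by exists (Ordinal jN) => /=; apply/andP; split; lra.
Qed.

Lemma cell1_inj (a l y : R) (j j' : nat) : 0 < l ->
  a + j%:R * l <= y < a + j%:R * l + l ->
  a + j'%:R * l <= y < a + j'%:R * l + l -> j = j'.
Proof.
move=> l0 /andP[h1 h2] /andP[h3 h4].
have lt1 (u v : nat) : u%:R * l < v%:R * l + l -> (u <= v)%N.
  by move=> h; rewrite -ltnS -(ltr_nat R) -(ltr_pM2r l0) -natr1; lra.
by apply/eqP; rewrite eqn_leq !lt1 //; lra.
Qed.

Lemma cell1_sub (a l : R) (N : nat) (j : 'I_N) : 0 <= l ->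
  a <= a + j%:R * l /\ a + j%:R * l + l <= a + N%:R * l.
Proof.
move=> l0; split; first by rewrite lerDl mulr_ge0.
rewrite -addrA lerD2l; have -> : j%:R * l + l = j.+1%:R * l by rewrite -natr1; lra.
by rewrite ler_wpM2r // ler_nat.
Qed.

End Rectangles.

(** * Children of a parabolic rectangle *)

Section Dyadic.
Variables (R : realType) (n d : nat) (p : R).
Hypothesis dp_ge : ln 9 / ln 2 <= d%:R * p.
Implicit Types (P Q : prect R n).

Let ratio : R := 2 `^ (d%:R * p).

Lemma ratio_ge9 : 9 <= ratio.
Proof.
have ln2 : 0 < ln 2 :> R by rewrite ln_gt0 // ltr1n.
have r0 : 0 < ratio by rewrite powR_gt0.
by rewrite -ler_ln ?posrE // ln_powR -ler_pdivrMr.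
Qed.

(** These are the bounds that keep the truncation of a child in [0, 1/2], by [dyadic1_gamma]. The
    threshold in [dyadic_k] is where (1 - gamma) ratio = (ratio + 1)/2: above this value the
    ceiling, being less than ratio + 1, is at most twice it; below it the floor, being more than
    ratio - 1, exceeds it since the ratio is at least 9. *)
Lemma dyadic_k_bounds (gamma : R) : 0 <= gamma <= 1 / 2 ->
  [/\ 0 < (dyadic_k p d gamma)%:R :> R,
      (1 - gamma) * ratio <= (dyadic_k p d gamma)%:R &
      (dyadic_k p d gamma)%:R / 2 <= (1 - gamma) * ratio].
Proof.
move=> /andP[g0 g1]; rewrite /dyadic_k -/ratio.
have a9 := ratio_ge9.
have a0 : 0 < ratio by lra.
rewrite powRD ?pnatr_eq0 ?implybT // -/ratio powRr1 //.
have eqn : (ratio + 1) / (ratio * 2) * ratio = (ratio + 1) / 2 by field; lra.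
case: ifP => hg; rewrite natr_absz ger0_norm.
- have /andP[c1 c2] := ceil_itv ratio.
  have c3 : (Num.ceil ratio)%:~R < ratio + 1 by move: c1; rewrite intrD; lra.
  have : (ratio + 1) / (ratio * 2) * ratio <= (1 - gamma) * ratio.
    by rewrite ler_pM2r //; lra.
  rewrite eqn => h; split; nra.
- by rewrite -(ler_int R); have /andP[_ c2] := ceil_itv ratio; apply: le_trans c2; lra.
- have /andP[c1 c2] := floor_itv ratio; rewrite intrD in c2.
  have : (1 - gamma) * ratio < (ratio + 1) / (ratio * 2) * ratio.
    by rewrite ltr_pM2r //; lra.
  rewrite eqn => h; split; nra.
- by rewrite floor_ge0; lra.
Qed.

Lemma powR_div2d (l : R) : 0 < l -> (l / 2 ^+ d) `^ p = l `^ p / ratio.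
Proof.
move=> l0; rewrite powRM ?invr_ge0 ?exprn_ge0 ?(ltW l0) //.
rewrite -powR_inv1 ?exprn_ge0 // -!powR_mulrn // -!powRrM /ratio -powRN.
by congr (_ * 2 `^ _); lra.
Qed.

(** The value does not depend on the child. Hence a whole generation shares one truncation
    parameter, and with it one time length. *)
Lemma dyadic1_gamma P Q : is_prect P -> dyadic1 p d P Q ->
  1 - pgamma Q = (1 - pgamma P) * ratio / (dyadic_k p d (pgamma P))%:R.
Proof.
case=> l0 g01 [hx ht _]; have [k0 _ _] := dyadic_k_bounds g01.
have a9 := ratio_ge9; have w0 := powR_gt0 p l0.
move: ht; rewrite /plt hx powR_div2d //.
set w := plx P `^ p in w0 *; set k := _%:R in k0 * => h.
have -> : 1 - pgamma Q = (1 - pgamma Q) * (w / ratio) * (ratio / w) by field; lra.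
by rewrite h; field; lra.
Qed.

Lemma dyadic1_prect P Q : is_prect P -> dyadic1 p d P Q -> is_prect Q.
Proof.
move=> hP hQ; have := dyadic1_gamma hP hQ.
case: hP hQ => l0 g01 [hx ht _] gQ; have [k0 k1 k2] := dyadic_k_bounds g01.
split; first by rewrite hx divr_gt0 // exprn_gt0.
suff : 1 / 2 <= 1 - pgamma Q <= 1 by lra.
by rewrite gQ ler_pdivlMr // ler_pdivrMr //; apply/andP; split; lra.
Qed.

Lemma dyadic1_rbox P Q : is_prect P -> dyadic1 p d P Q ->
  exists (j : 'I_n -> 'I_(2 ^ d)) (m : 'I_(dyadic_k p d (pgamma P))),
  prect_set p Q = rbox (fun i => pleft P i + (j i)%:R * (plx P / 2 ^+ d))
    (pbottom p P + m%:R * (plt p P / (dyadic_k p d (pgamma P))%:R))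
    (plx P / 2 ^+ d) (plt p P / (dyadic_k p d (pgamma P))%:R).
Proof.
move=> hP [hx ht [j [m [hj hm]]]]; exists j, m.
rewrite prect_setE hm hx ht; congr rbox.
by apply/funext => i; rewrite hj hx.
Qed.

Lemma dyadic1_sub P Q : is_prect P -> dyadic1 p d P Q ->
  prect_set p Q `<=` prect_set p P.
Proof.
move=> hP hQ; have [j [m ->]] := dyadic1_rbox hP hQ; rewrite prect_setE.
have [k0 _ _] := dyadic_k_bounds hP.2.
have l0 : 0 <= plx P / 2 ^+ d by rewrite divr_ge0 ?exprn_ge0 // ltW ?plx_gt0.
have t0 : 0 <= plt p P / (dyadic_k p d (pgamma P))%:R.
  by rewrite divr_ge0 ?ler0n // ltW ?plt_gt0.
apply: rbox_subset => [i||].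
- have := cell1_sub (pleft P i) (j i) l0.
  by rewrite natrX mul_divK ?expf_neq0 ?pnatr_eq0.
- exact: (cell1_sub (pbottom p P) m t0).1.
have := (cell1_sub (pbottom p P) m t0).2.
by rewrite mul_divK ?gt_eqF.
Qed.

(** [dyadic1] prescribes edges and corners; here the parameters are solved for, the truncation from
    (1 - gamma) l^p = t. Indexing by finite functions makes the children a finite type over which
    volumes can be summed. *)
Definition cell P (jm : {ffun 'I_n -> 'I_(2 ^ d)} * 'I_(dyadic_k p d (pgamma P))) :
    prect R n :=
  let l := plx P / 2 ^+ d in
  let t := plt p P / (dyadic_k p d (pgamma P))%:R in
  PRect (\row_i (pleft P i + (jm.1 i)%:R * l + l / 2))
    (pbottom p P + jm.2%:R * t + l `^ p) l (1 - t / l `^ p).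

Lemma cell_dyadic1 P jm : is_prect P -> dyadic1 p d P (@cell P jm).
Proof.
move=> hP; have l0 : 0 < plx P / 2 ^+ d by rewrite divr_gt0 ?exprn_gt0 ?plx_gt0.
have w0 := powR_gt0 p l0.
have ht : plt p (@cell P jm) = plt p P / (dyadic_k p d (pgamma P))%:R.
  by rewrite {1}/plt /= opprB addrC subrK divfK ?gt_eqF.
split => //; exists jm.1, jm.2; split => [i|].
  by rewrite {1}/pleft /= mxE addrK.
by rewrite ht {1}/pbottom /= addrK.
Qed.

Lemma cell_rbox P jm : is_prect P -> prect_set p (@cell P jm) =
  rbox (fun i => pleft P i + (jm.1 i)%:R * (plx P / 2 ^+ d))
    (pbottom p P + jm.2%:R * (plt p P / (dyadic_k p d (pgamma P))%:R))
    (plx P / 2 ^+ d) (plt p P / (dyadic_k p d (pgamma P))%:R).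
Proof.
move=> hP; have l0 : 0 < plx P / 2 ^+ d by rewrite divr_gt0 ?exprn_gt0 ?plx_gt0.
have w0 := powR_gt0 p l0.
have ht : plt p (@cell P jm) = plt p P / (dyadic_k p d (pgamma P))%:R.
  by rewrite {1}/plt /= opprB addrC subrK divfK ?gt_eqF.
rewrite prect_setE ht; congr rbox; last by rewrite {1}/pbottom /= addrK.
by apply/funext => i; rewrite {1}/pleft /= mxE addrK.
Qed.

Lemma cell_cover P z : is_prect P -> prect_set p P z ->
  exists jm, prect_set p (@cell P jm) z.
Proof.
move=> hP; rewrite prect_setE => -[z1 z2].
have [k0 _ _] := dyadic_k_bounds hP.2.
have l0 : 0 < plx P / 2 ^+ d by rewrite divr_gt0 ?exprn_gt0 ?plx_gt0.
have t0 : 0 < plt p P / (dyadic_k p d (pgamma P))%:R by rewrite divr_gt0 ?plt_gt0.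
have [m hm] : exists m : 'I_(dyadic_k p d (pgamma P)), pbottom p P +
    m%:R * (plt p P / (dyadic_k p d (pgamma P))%:R) <= z.2 < pbottom p P +
    m%:R * (plt p P / (dyadic_k p d (pgamma P))%:R) +
    plt p P / (dyadic_k p d (pgamma P))%:R.
  by apply: cell1_cover => //; rewrite mul_divK ?gt_eqF.
have /choice[j hj] : forall i, exists j : 'I_(2 ^ d), pleft P i +
    j%:R * (plx P / 2 ^+ d) <= z.1 ord0 i < pleft P i +
    j%:R * (plx P / 2 ^+ d) + plx P / 2 ^+ d.
  move=> i; apply: cell1_cover => //.
  by rewrite natrX mul_divK ?expf_neq0 ?pnatr_eq0 ?z1.
exists ([ffun i => j i], m); rewrite cell_rbox //; split => // i /=.
by rewrite ffunE.
Qed.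

Lemma cell_disjoint P jm jm' z : is_prect P ->
  prect_set p (@cell P jm) z -> prect_set p (@cell P jm') z -> jm = jm'.
Proof.
move=> hP; rewrite !cell_rbox // => -[z1 z2] [z3 z4].
have [k0 _ _] := dyadic_k_bounds hP.2.
have l0 : 0 < plx P / 2 ^+ d by rewrite divr_gt0 ?exprn_gt0 ?plx_gt0.
have t0 : 0 < plt p P / (dyadic_k p d (pgamma P))%:R by rewrite divr_gt0 ?plt_gt0.
case: jm jm' z1 z2 z3 z4 => [j m] [j' m'] /= z1 z2 z3 z4; congr pair.
  by apply/ffunP => i; apply/val_inj; exact: (cell1_inj l0 (z1 i) (z3 i)).
by apply/val_inj; exact: (cell1_inj t0 z2 z4).
Qed.

Lemma cell_vol P jm : is_prect P ->
  (2 ^+ d) ^+ n * (dyadic_k p d (pgamma P))%:R *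
    (plx (@cell P jm) ^+ n * plt p (@cell P jm)) = plx P ^+ n * plt p P.
Proof.
move=> hP; have [k0 _ _] := dyadic_k_bounds hP.2.
have [-> -> _] := cell_dyadic1 jm hP; rewrite expr_div_n.
have h : (2 ^+ d) ^+ n != 0 :> R by rewrite !expf_neq0 ?pnatr_eq0.
by field; rewrite h gt_eqF.
Qed.

End Dyadic.

(** * Generations of the lattice and the largest free rectangle *)

Section Generations.
Variables (R : realType) (n d : nat) (p : R).
Hypotheses (n_gt0 : (0 < n)%N) (d_gt0 : (0 < d)%N) (p_gt1 : 1 < p).
Hypothesis dp_ge : ln 9 / ln 2 <= d%:R * p.
Implicit Types (P Q : prect R n) (E : set (spacetime R n)).

Lemma gen_prect i P Q : is_prect P -> dyadic_gen p d i P Q -> is_prect Q.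
Proof.
move=> hP; elim: i Q => [|i IH] Q /=; first by move=> ->.
by case=> Q' /IH hQ'; apply: dyadic1_prect.
Qed.

Lemma dyadic_prect P Q : is_prect P -> dyadic p d P Q -> is_prect Q.
Proof. by move=> hP [i _]; exact: gen_prect. Qed.

Lemma gen_plx i P Q : dyadic_gen p d i P Q -> plx Q = plx P / (2 ^+ d) ^+ i.
Proof.
elim: i Q => [|i IH] Q /=; first by move=> ->; rewrite divr1.
by case=> Q' /IH hQ' [-> _ _]; rewrite hQ' exprSr invfM mulrA.
Qed.

Lemma gen_pgamma i P Q Q' : is_prect P ->
  dyadic_gen p d i P Q -> dyadic_gen p d i P Q' -> pgamma Q = pgamma Q'.
Proof.
move=> hP; elim: i Q Q' => [|i IH] Q Q' /=; first by move=> -> ->.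
case=> Q1 g1 h1 [Q2 g2 h2]; have := dyadic1_gamma dp_ge (gen_prect hP g1) h1.
have := dyadic1_gamma dp_ge (gen_prect hP g2) h2.
by rewrite (IH _ _ g1 g2) => <- e; lra.
Qed.

Lemma gen_sub i P Q : is_prect P -> dyadic_gen p d i P Q ->
  prect_set p Q `<=` prect_set p P.
Proof.
move=> hP; elim: i Q => [|i IH] Q /=; first by move=> ->.
case=> Q' g' h'; apply: subset_trans (IH _ g').
exact: (dyadic1_sub dp_ge (gen_prect hP g') h').
Qed.

Lemma dyadic_sub P Q : is_prect P -> dyadic p d P Q ->
  prect_set p Q `<=` prect_set p P.
Proof. by move=> hP [i _]; exact: gen_sub. Qed.

Lemma dyadic1_trans P Q S : dyadic1 p d P Q -> dyadic p d Q S -> dyadic p d P S.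
Proof.
move=> h [i _ g]; exists i.+1 => //; elim: i S g => [|i IH] S /=.
  by move=> ->; exists P.
by case=> S' /IH hS' h'; exists S'.
Qed.

Lemma gen_cover i P z : is_prect P -> prect_set p P z ->
  exists2 Q, dyadic_gen p d i P Q & prect_set p Q z.
Proof.
move=> hP hz; elim: i => [|i [Q gQ zQ]]; first by exists P.
have hQ := gen_prect hP gQ; have [jm zjm] := cell_cover dp_ge hQ zQ.
by exists (cell jm) => //=; exists Q => //; apply: cell_dyadic1.
Qed.

Lemma gen_plx_le i j P Q Q' : is_prect P -> (i <= j)%N ->
  dyadic_gen p d i P Q -> dyadic_gen p d j P Q' -> plx Q' <= plx Q.
Proof.
move=> hP ij /gen_plx -> /gen_plx ->; rewrite ler_pM2l ?plx_gt0 //.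
rewrite lef_pV2 ?posrE ?exprn_gt0 // ler_weXn2l //.
by apply: exprn_ege1; rewrite ler1n.
Qed.

Lemma gen_plx_lt i j P Q Q' : is_prect P -> (i < j)%N ->
  dyadic_gen p d i P Q -> dyadic_gen p d j P Q' -> plx Q' < plx Q.
Proof.
move=> hP ij /gen_plx -> /gen_plx ->; rewrite ltr_pM2l ?plx_gt0 //.
rewrite ltf_pV2 ?posrE ?exprn_gt0 // ltr_eXn2l //.
apply: (@lt_le_trans _ _ 2); first by rewrite ltr1n.
by rewrite -[leLHS]expr1 ler_weXn2l // ler1n.
Qed.

(* A free member of least generation is maximal, as the time lengths within a
   generation agree. *)
Lemma exists_maximal_free E P Q : is_prect P -> dyadic p d P Q ->
  set_free E (prect_set p Q) ->
  exists2 Q0, maximal_free p d E P Q0 & plx Q <= plx Q0.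
Proof.
move=> hP [i0 _ gQ] fQ.
pose G i := `[< exists Q1, dyadic_gen p d i P Q1 /\ set_free E (prect_set p Q1) >].
have exG : exists i, G i by exists i0; apply/asboolP; exists Q.
case: (ex_minnP exG) => i /asboolP[Q0 [g0 f0]] imin.
have le_i j Q' : dyadic_gen p d j P Q' -> set_free E (prect_set p Q') -> (i <= j)%N.
  by move=> g' f'; apply: imin; apply/asboolP; exists Q'.
exists Q0; last exact: (gen_plx_le hP (le_i _ _ gQ fQ) g0 gQ).
split => //; first by exists i.
move=> Q' [j _ g'] f' sub.
have h0 := gen_prect hP g0; have h' := gen_prect hP g'.
move: sub; rewrite !prect_setE => sub.
have [sub1 _] := rbox_sub (plx_gt0 h0) (plt_gt0 p h0) sub.
have eqij : i = j.
  apply/eqP; rewrite eqn_leq (le_i _ _ g' f') /= leqNgt; apply/negP => ij.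
  have := gen_plx_lt hP ij g0 g'; have := sub1 (Ordinal n_gt0); lra.
subst j.
have ex : plx Q' = plx Q0 by rewrite (gen_plx g') (gen_plx g0).
have et : plt p Q' = plt p Q0 by rewrite /plt ex (gen_pgamma hP g' g0).
rewrite ex et in sub *.
by apply: rbox_sub_eq => //; [apply: plx_gt0 | apply: plt_gt0].
Qed.

Lemma largest_free_ge E P Q : is_prect P -> dyadic p d P Q ->
  set_free E (prect_set p Q) ->
  exists Q0, [/\ dyadic p d P Q0, largest_free p d E P = prect_set p Q0 &
    plx Q <= plx Q0].
Proof.
move=> hP dQ fQ; rewrite /largest_free.
set A := [set _ | _ in _].
have exA : exists s, A s.
  (* Sides decrease with the generation, so a maximal free member of least generation has the
     largest side. *)
  pose G i := `[< exists Q1, dyadic_gen p d i P Q1 /\ maximal_free p d E P Q1 >].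
  have [Q1 m1 _] := exists_maximal_free hP dQ fQ.
  have exG : exists i, G i.
    by case: (m1) => -[i _ g1] _ _; exists i; apply/asboolP; exists Q1.
  case: (ex_minnP exG) => i /asboolP[Q0 [g0 m0]] imin.
  exists (prect_set p Q0), Q0 => //; split => // Q' m'.
  have [[j _ g'] _ _] := m'.
  have ij : (i <= j)%N by apply: imin; apply/asboolP; exists Q'.
  exact: (gen_plx_le hP ij g0 g').
have [Q0 [m0 hmax] <-] := xgetPex set0 exA.
exists Q0; split => //; first by case: m0.
have [Q1 m1 le1] := exists_maximal_free hP dQ fQ.
exact: le_trans le1 (hmax _ m1).
Qed.

Lemma largest_freeP E P :
  largest_free p d E P = set0 \/
  exists Q, [/\ dyadic p d P Q, set_free E (prect_set p Q) &
    largest_free p d E P = prect_set p Q].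
Proof.
rewrite /largest_free; set A := [set _ | _ in _].
have [exA|nA] := pselect (exists s, A s); last first.
  by left; apply: xgetPN => s As; apply: nA; exists s.
right; have [Q0 [[d0 f0 _] _] <-] := xgetPex set0 exA.
by exists Q0.
Qed.

(** Take the first generation of side at most s/2 and its member containing the centre of the cube.
    It stays in the cube, in time because its length is at most (s/2)^p <= s^p/2. The generation
    before has side above s/2, whence the lower bound. *)
Lemma dyadic_in_cube E P y u (s : R) : is_prect P -> 0 < s ->
  rbox y u s (s `^ p) `<=` prect_set p P -> set_free E (rbox y u s (s `^ p)) ->
  exists Q, [/\ dyadic p d P Q, set_free E (prect_set p Q) & s / 2 / 2 ^+ d <= plx Q].
Proof.
move=> hP s0 sub fr.
have l0 := plx_gt0 hP.
have sp0 := powR_gt0 p s0.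
have sl : s <= plx P.
  move: sub; rewrite prect_setE => /(rbox_sub s0 sp0) [/(_ (Ordinal n_gt0))] [? ?] _.
  lra.
have d2 : 2 <= 2 ^+ d :> R by rewrite -[leLHS]expr1 ler_weXn2l // ler1n.
pose G i := plx P / (2 ^+ d) ^+ i <= s / 2.
have exG : exists i, G i.
  have [i hi] : exists i : nat, plx P / (s / 2) < 2 ^+ i.
    by exists (Num.bound (plx P / (s / 2))); apply: upper_nthrootP.
  exists i; rewrite /G ler_pdivrMr ?exprn_gt0 //.
  rewrite ltr_pdivrMr in hi; last by lra.
  have : 2 ^+ i <= (2 ^+ d) ^+ i :> R by apply: lerXn2r; rewrite ?nnegrE ?exprn_ge0.
  by nra.
case: (ex_minnP exG) => i hi imin.
pose z : spacetime R n := (\row_j (y j + s / 2), u + s `^ p / 2).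
have hz : rbox y u s (s `^ p) z.
  by split => [j|] /=; rewrite ?mxE; lra.
have [Q gQ zQ] := gen_cover i hP (sub _ hz).
have hQ := gen_prect hP gQ; have xQ := gen_plx gQ.
have ls : plx Q <= s / 2 by rewrite xQ.
clear hi; exists Q; split; first by exists i.
- apply: subsetI_eq0 fr; last by [].
  have ts : plt p Q <= s `^ p / 2.
    have /andP[_ h] := plt_bounds p hQ; apply: le_trans h _.
    have h1 : plx Q `^ p <= (s / 2) `^ p.
      have q0 := ltW (plx_gt0 hQ); have s20 : 0 <= s / 2 by lra.
      by rewrite ge0_ler_powR ?nnegrE // (le_trans ler01) // ltW.
    apply: le_trans h1 _; rewrite powRM ?(ltW s0) // ler_pM2l //.
    by apply: ge1r_powR; [apply/andP; split; lra | exact: ltW].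
  move: zQ; rewrite prect_setE => -[/= z1 z2]; apply: rbox_subset => [j||].
  + by have := z1 j; rewrite mxE => /andP[? ?]; lra.
  + by case/andP: z2; lra.
  + by case/andP: z2; lra.
(* Generation 0 is excluded: the cube fits in [P], so the side of [P] is at least [s]. *)
case: i imin {gQ} xQ => [|i] imin xQ; first by move: xQ; rewrite expr0 divr1; lra.
rewrite xQ.
have : ~~ G i by apply/negP => /imin; rewrite ltnn.
rewrite /G -ltNge => h; rewrite exprSr invfM mulrA.
by rewrite ler_pM2r ?invr_gt0 ?exprn_gt0 // ltW.
Qed.

Lemma largest_free_cube E P y u (s : R) : is_prect P -> 0 < s ->
  rbox y u s (s `^ p) `<=` prect_set p P -> set_free E (rbox y u s (s `^ p)) ->
  exists Q, [/\ is_prect Q, largest_free p d E P = prect_set p Q &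
    s / 2 / 2 ^+ d <= plx Q].
Proof.
move=> hP s0 sub fr; have [Q1 [d1 f1 l1]] := dyadic_in_cube hP s0 sub fr.
have [Q [dQ -> lQ]] := largest_free_ge hP d1 f1.
by exists Q; split; [exact: dyadic_prect dQ | | exact: le_trans lQ].
Qed.

End Generations.

(** * Porous families *)

Section Families.
Variables (R : realType) (n d : nat) (p : R).
Hypotheses (n_gt0 : (0 < n)%N) (d_gt0 : (0 < d)%N) (p_gt1 : 1 < p).
Hypothesis dp_ge : ln 9 / ln 2 <= d%:R * p.
Implicit Types (P Q : prect R n) (E : set (spacetime R n)).

(** The common shape of weak porosity and of the conclusion, with a free threshold [A] in place of
    the multiple of the largest free volume. Families of different cells can be united because they
    share the same [A]. *)
Definition good_family (c : R) (A : \bar R) E P : Prop :=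
  exists (N : nat) (S : 'I_N -> prect R n),
    [/\ disjoint_free p d E P S, forall i, (A <= pmeas p (S i))%E &
        (c%:E * pmeas p P <= \sum_(i < N) pmeas p (S i))%E].

Lemma good_family_fin (c : R) (A : \bar R) E P (I : finType) (S : I -> prect R n) :
  (forall i, dyadic p d P (S i)) -> (forall i, set_free E (prect_set p (S i))) ->
  (forall i j, i != j -> prect_set p (S i) `&` prect_set p (S j) = set0) ->
  (forall i, (A <= pmeas p (S i))%E) ->
  (c%:E * pmeas p P <= \sum_i pmeas p (S i))%E -> good_family c A E P.
Proof.
move=> hd hf hdisj hA hc; exists #|I|, (S \o enum_val); split => //=.
  split => [i|i|i j ij] /=; [exact: hd | exact: hf |].
  by apply: hdisj; apply: contra_neq ij; exact: enum_val_inj.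
apply: le_trans hc _; rewrite (reindex (@enum_val I I)) //.
by apply: onW_bij; exact: enum_val_bij.
Qed.

(** The families of all children are put together. Members from different children are disjoint
    since the children are, and [c] is kept since the children have equal volumes adding up to that
    of [P]. *)
Lemma good_family_child (c : R) (A : \bar R) E P : is_prect P ->
  (forall Q, dyadic1 p d P Q -> good_family c A E Q) -> good_family c A E P.
Proof.
move=> hP H.
have hcell jm := cell_dyadic1 (p := p) (d := d) jm hP.
have hcp jm := dyadic1_prect dp_ge hP (hcell jm).
have /choice[F hF] : forall jm, exists F : {N : nat & 'I_N -> prect R n},
   [/\ disjoint_free p d E (cell jm) (tagged F),
       forall i, (A <= pmeas p (tagged F i))%E &
       (c%:E * pmeas p (@cell R n d p P jm) <= \sum_i pmeas p (tagged F i))%E].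
  by move=> jm; have [N [S hS]] := H _ (hcell jm); exists (Tagged _ S).
have hFd jm i : dyadic p d (cell jm) (tagged (F jm) i).
  by have [[h _ _] _ _] := hF jm; exact: h.
pose T := {jm : {ffun 'I_n -> 'I_(2 ^ d)} * 'I_(dyadic_k p d (pgamma P)) &
  'I_(tag (F jm))}.
pose S (x : T) := tagged (F (tag x)) (tagged x).
apply: (@good_family_fin _ _ _ _ T S) => [x|x|x y xy|x|].
- exact: dyadic1_trans (hcell _) (hFd _ _).
- by have [[_ h _] _ _] := hF (tag x); exact: h.
- apply/seteqP; split => // z [z1 z2].
  have zx := dyadic_sub dp_ge (hcp _) (hFd _ _) z1.
  have zy := dyadic_sub dp_ge (hcp _) (hFd _ _) z2.
  have e := cell_disjoint dp_ge hP zx zy.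
  case: x y xy z1 z2 e {zx zy} => [jm i] [jm' i'] /= xy z1 z2 e; subst jm'.
  have [[_ _ h] _ _] := hF jm.
  have ii' : i != i' by apply: contraNneq xy => ->.
  by have : (set0 : set (spacetime R n)) z by rewrite -(h _ _ ii').
- by have [_ h _] := hF (tag x); exact: h.
rewrite -(sig_big_dep xpredT (fun _ => xpredT) (fun jm i => pmeas p (tagged (F jm) i))).
have hS jm i := pmeasE p (dyadic_prect dp_ge (hcp jm) (hFd jm i)).
have -> : (\sum_jm \sum_i pmeas p (tagged (F jm) i))%E =
   (\sum_jm \sum_i plx (tagged (F jm) i) ^+ n * plt p (tagged (F jm) i))%:E.
  by rewrite -sumEFin; apply: eq_bigr => jm _; rewrite -sumEFin; apply: eq_bigr => i _; exact: hS.
rewrite pmeasE // -EFinM lee_fin.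
have le1 jm : c * (plx (@cell R n d p P jm) ^+ n * plt p (cell jm)) <=
    \sum_i plx (tagged (F jm) i) ^+ n * plt p (tagged (F jm) i).
  have [_ _] := hF jm; rewrite pmeasE // -EFinM -lee_fin -sumEFin.
  by under eq_bigr do rewrite hS.
apply: le_trans (ler_sum _ (fun jm _ => le1 jm)).
have [k0 _ _] := dyadic_k_bounds dp_ge hP.2.
set a := plx P ^+ n * _.
have K0 : (2 ^+ d) ^+ n * (dyadic_k p d (pgamma P))%:R != 0 :> R.
  by rewrite mulf_neq0 ?(gt_eqF k0) // !expf_neq0 ?pnatr_eq0.
rewrite (eq_bigr (fun=> c * (a / ((2 ^+ d) ^+ n * (dyadic_k p d (pgamma P))%:R)))).
  rewrite sumr_const card_prod card_ffun !card_ord -[leRHS]mulr_natr natrM !natrX.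
  by rewrite -[leRHS]mulrA divfK.
by move=> jm _; rewrite /a -(cell_vol dp_ge jm hP) mulrAC divff // mul1r.
Qed.

Lemma good_family_gen m (c : R) (A : \bar R) E P : is_prect P ->
  (forall Q, dyadic_gen p d m P Q -> good_family c A E Q) -> good_family c A E P.
Proof.
move=> hP; elim: m => [|m IH] H; first exact: H.
apply: IH => Q gQ; apply: good_family_child (gen_prect dp_ge hP gQ) _ => Q' h.
by apply: H; exists Q.
Qed.

(** Cubes are given by their lower corner and need not be dyadic, so the positions along a chain can
    be chosen freely. *)
Definition free_cube E (x : 'I_n -> R) (t l s : R) : Prop :=
  exists (y : 'I_n -> R) (u : R), rbox y u s (s `^ p) `<=` rbox x t l (l `^ p) /\
    set_free E (rbox y u s (s `^ p)).

Lemma set_free_sub E A B : A `<=` B -> set_free E B -> set_free E A.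
Proof. by move=> AB fB; apply: subsetI_eq0 fB. Qed.

(** The free cube forces the largest free rectangle of the shifted [P] to have side at least [q];
    its truncation is at most 1/2, which accounts for the halved [delta]. *)
Lemma porous_good_family E (c delta theta s : R) P :
  weakly_porous p d c delta theta E -> is_prect P -> 0 < s ->
  (exists (y : 'I_n -> R) (u : R), rbox y u s (s `^ p) `<=` prect_set p (pshift p theta P) /\
     set_free E (rbox y u s (s `^ p))) ->
  let q := s / 2 / 2 ^+ d in
  good_family c (delta / 2 * (q ^+ n * q `^ p))%:E E P.
Proof.
move=> [_ /andP[de0 _] _ _ por] hP s0 [y [u [sub fr]]] q.
have [N [S [hS hA hc]]] := por P hP; exists N, S; split => // i.
have [Q [hQ eQ lQ]] := largest_free_cube n_gt0 d_gt0 p_gt1 dp_ge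
  (pshift_prect p theta hP) s0 sub fr.
apply: le_trans (hA i); rewrite eQ.
have -> : Defs.lebesgue_pt (prect_set p Q) = pmeas p Q by [].
rewrite pmeasE // -EFinM lee_fin -mulrA ler_pM2l //.
have /andP[h _] := plt_bounds p hQ.
have q0 : 0 <= q by rewrite !divr_ge0 ?exprn_ge0 // ltW.
have x0 := ltW (plx_gt0 hQ).
have h1 : q ^+ n <= plx Q ^+ n by rewrite lerXn2r.
have h2 : q `^ p <= plx Q `^ p.
  by rewrite ge0_ler_powR ?nnegrE // (le_trans ler01) // ltW.
rewrite mulrCA; apply: ler_pM => //; first by rewrite exprn_ge0.
  by rewrite mulr_ge0 ?powR_ge0.
by apply: le_trans h; rewrite mulrC ler_pM2r.
Qed.

(** Scaling gives the factor e^(1/(n+p)); as e <= 1, the weaker factor [e] holds too and avoids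
    roots. Only some power of [delta] matters in the end. *)
Lemma cube_weight_inv (e q x : R) : 0 < e <= 1 -> 0 < q -> 0 <= x ->
  e * (q ^+ n * q `^ p) <= x ^+ n * x `^ p -> e * q <= x.
Proof.
move=> /andP[e0 e1] q0 x0 h; rewrite leNgt; apply/negP => lt.
have p0 : 0 < p by exact: lt_trans p_gt1.
have eq0 : 0 < e * q by rewrite mulr_gt0.
have h1 : x ^+ n <= (e * q) ^+ n by rewrite lerXn2r ?nnegrE ?(ltW eq0) ?(ltW lt).
have h2 : x `^ p < (e * q) `^ p by rewrite gt0_ltr_powR ?nnegrE // ltW.
have h3 : x ^+ n * x `^ p < (e * q) ^+ n * (e * q) `^ p.
  apply: (@le_lt_trans _ _ ((e * q) ^+ n * x `^ p)).
    by rewrite ler_wpM2r ?powR_ge0.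
  by rewrite ltr_pM2l ?exprn_gt0.
have h4 : (e * q) ^+ n * (e * q) `^ p <= e * (q ^+ n * q `^ p).
  rewrite exprMn powRM ?(ltW e0) ?(ltW q0) // mulrACA ler_pM2r; last first.
    by rewrite mulr_gt0 ?exprn_gt0 ?powR_gt0.
  have e2 : e ^+ n <= 1 by rewrite exprn_ile1 // ltW.
  have e3 : e `^ p <= e by apply: ge1r_powR; rewrite ?e0 ?e1 // ltW.
  rewrite -[leRHS]mul1r; apply: ler_pM => //; rewrite ?powR_ge0 //.
  by rewrite exprn_ge0 // ltW.
by have := lt_le_trans h3 h4; rewrite ltNge h.
Qed.

End Families.

(** * Chains of parabolic cubes *)

Section Chains.
Variables (R : realType) (n d : nat) (p : R).
Hypotheses (n_gt0 : (0 < n)%N) (d_gt0 : (0 < d)%N) (p_gt1 : 1 < p).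
Hypothesis dp_ge : ln 9 / ln 2 <= d%:R * p.
Implicit Types (P Q : prect R n) (E : set (spacetime R n)).

Definition cube_prect (x : 'I_n -> R) (t l : R) : prect R n :=
  PRect (\row_i (x i + l / 2)) (t + l `^ p) l 0.

Lemma cube_prectP x t l : 0 < l -> is_prect (cube_prect x t l).
Proof. by move=> l0; split; rewrite //= lexx divr_ge0. Qed.

Lemma cube_plt x t l : plt p (cube_prect x t l) = l `^ p.
Proof. by rewrite /plt /= subr0 mul1r. Qed.

Lemma cube_pbottom x t l : pbottom p (cube_prect x t l) = t.
Proof. by rewrite /pbottom /= addrK. Qed.

Lemma cube_pleft x t l : pleft (cube_prect x t l) = x.
Proof. by apply/funext => i; rewrite /pleft /= mxE addrK. Qed.

Lemma pleft_shift theta P : pleft (pshift p theta P) = pleft P.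
Proof. by []. Qed.

Lemma cube_prect_shift x t l theta :
  prect_set p (pshift p theta (cube_prect x t l)) =
  rbox x (t + theta * l `^ p) l (l `^ p).
Proof.
by rewrite prect_setE pshift_bottom pshift_plt cube_pbottom cube_plt pleft_shift cube_pleft.
Qed.

Lemma cube_prect_set x t l : prect_set p (cube_prect x t l) = rbox x t l (l `^ p).
Proof. by rewrite prect_setE cube_plt cube_pbottom cube_pleft. Qed.

Lemma powR_half_le (s x : R) : 0 < s -> 0 <= x -> x <= s / 2 -> x `^ p <= s `^ p / 2.
Proof.
move=> s0 x0 xs; apply: (@le_trans _ _ ((s / 2) `^ p)).
  by rewrite ge0_ler_powR ?nnegrE ?divr_ge0 ?(ltW s0) // (le_trans ler01) // ltW.
rewrite powRM ?(ltW s0) // ler_pM2l ?powR_gt0 //.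
by apply: ge1r_powR; [apply/andP; split; lra | exact: ltW].
Qed.

(* The porous family of the cube at (x', t') loses at most half of its volume
   when intersected with the nearby cube at (x, t). *)
Lemma free_cube_step E (c delta theta c0 eta l s : R) x t x' t' :
  weakly_porous p d c delta theta E -> 0 < c0 -> c0 <= c ->
  0 <= eta <= 1 -> 1 - c0 / 2 <= (1 - eta) ^+ n.+1 -> 0 < l -> 0 < s ->
  (forall i, `|x i - x' i| <= eta * l) -> `|t - t'| <= eta * l `^ p ->
  free_cube p E x' (t' + theta * l `^ p) l s ->
  free_cube p E x t l (delta / 16 / 2 ^+ d * s).
Proof.
move=> wp c00 c0c eta01 hc l0 s0 hx ht fc.
have hP := cube_prectP x' t' l0.
have lp0 := powR_gt0 p l0.
have /(porous_good_family n_gt0 d_gt0 p_gt1 dp_ge wp hP s0) : exists (y : 'I_n -> R) (u : R),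
    (rbox y u s (s `^ p) `<=` prect_set p (pshift p theta (cube_prect x' t' l)))%classic
    /\ set_free E (rbox y u s (s `^ p)).
  by rewrite cube_prect_shift.
set q := s / 2 / 2 ^+ d => -[N [S [[Sd Sf Sdisj] SA Sc]]].
have q0 : 0 < q by rewrite !divr_gt0 ?exprn_gt0.
have hS i := dyadic_prect dp_ge hP (Sd i).
have [_ /andP[de0 de1] _ _ _] := wp.
have c_gt0 : 0 < c by exact: lt_le_trans c0c.
have [||||||k [y [u sub]]] := @rbox_half_overlap R n 'I_N (fun i => pleft (S i))
   (fun i => pbottom p (S i)) (fun i => plx (S i)) (fun i => plt p (S i))
   x' t' x t l (l `^ p) eta c (fun i => plx_gt0 (hS i)) (fun i => plt_gt0 p (hS i))
   l0 lp0 c_gt0 eta01.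
- by apply: le_trans hc; lra.
- exact: hx.
- exact: ht.
- move=> k; have := dyadic_sub dp_ge hP (Sd k).
  by rewrite cube_prect_set prect_setE.
- by move=> k k' kk'; have := Sdisj _ _ kk'; rewrite !prect_setE.
- move: Sc; rewrite pmeasE // cube_plt -EFinM -lee_fin -sumEFin => h.
  apply: le_trans h _; rewrite le_eqVlt; apply/orP; left.
  by apply/eqP/eq_bigr => i _; rewrite pmeasE.
have xk0 := plx_gt0 (hS k).
have xk : delta / 2 * q <= plx (S k).
  apply: (cube_weight_inv (n := n) p_gt1 _ q0 (ltW xk0)).
    by apply/andP; split; lra.
  have := SA k; rewrite pmeasE // lee_fin => h; apply: le_trans h _.
  by rewrite ler_pM2l ?exprn_gt0 //; have /andP[] := plt_bounds p (hS k).
(* The factor 1/4 fits a cube into the halved box of [S k]: with x the side of [S k], r <= x/4 gives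
   r^p <= x^p/4, at most half of the time length since the truncation is at most 1/2. *)
have -> : delta / 16 / 2 ^+ d * s = delta / 2 * q / 4 by rewrite /q; lra.
set r := delta / 2 * q / 4.
have r0 : 0 < r by rewrite /r !mulr_gt0.
have rt : r `^ p <= plt p (S k) / 2.
  have h1 : r `^ p <= (plx (S k) / 2) `^ p / 2.
    by apply: powR_half_le; rewrite ?divr_gt0 ?(ltW r0) // /r; lra.
  have h2 : (plx (S k) / 2) `^ p <= plx (S k) `^ p / 2.
    by apply: powR_half_le; rewrite ?divr_ge0 // ltW.
  have /andP[h3 _] := plt_bounds p (hS k).
  by lra.
have sub2 : (rbox y u r (r `^ p) `<=` rbox y u (plx (S k) / 2) (plt p (S k) / 2))%classic.
  apply: rbox_subset => // [i|]; last by rewrite lerD2l.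
  by split => //; rewrite lerD2l /r; lra.
exists y, u; split.
  by move=> z /sub2 /sub [].
apply: set_free_sub (Sf k) => z /sub2 /sub [h _].
by rewrite prect_setE.
Qed.

(** The segment from (x', t') back to (x, t) is cut into [K] equal steps, each within the tolerance
    of [free_cube_step]. *)
Lemma free_cube_chain E (c delta theta c0 eta l s : R) (K : nat) x t x' t' :
  weakly_porous p d c delta theta E -> 0 < c0 -> c0 <= c ->
  0 <= eta <= 1 -> 1 - c0 / 2 <= (1 - eta) ^+ n.+1 -> 0 < l -> 0 < s ->
  (0 < K)%N ->
  (forall i, `|x' i - x i| <= K%:R * (eta * l)) ->
  `|t' - t - K%:R * (theta * l `^ p)| <= K%:R * (eta * l `^ p) ->
  free_cube p E x' t' l s ->
  free_cube p E x t l ((delta / 16 / 2 ^+ d) ^+ K * s).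
Proof.
move=> wp c00 c0c eta01 hc l0 s0 K0 hx ht fc.
have [_ /andP[de0 de1] _ _ _] := wp.
have k0 : 0 < delta / 16 / 2 ^+ d by rewrite !divr_gt0 ?exprn_gt0.
have KR : 0 < K%:R :> R by rewrite ltr0n.
pose X (j : nat) i := x' i - j%:R / K%:R * (x' i - x i).
pose T (j : nat) := t' - j%:R / K%:R * (t' - t).
have chain j : free_cube p E (X j) (T j) l ((delta / 16 / 2 ^+ d) ^+ j * s).
  elim: j => [|j IH].
    have -> : X 0%N = x' by apply/funext => i; rewrite /X !mul0r subr0.
    have -> : T 0%N = t' by rewrite /T !mul0r subr0.
    by rewrite expr0 mul1r.
  rewrite exprS -mulrA.
  (* The auxiliary cube sits [theta] time lengths before the current one, so that its shift is
     exactly the cube already known to contain a free cube. *)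
  apply: (free_cube_step wp c00 c0c eta01 hc l0 _ (x' := X j)
    (t' := T j - theta * l `^ p)); last by rewrite subrK.
  - by rewrite mulr_gt0 ?exprn_gt0.
  - move=> i; rewrite -(ler_pM2l KR); apply: le_trans (hx i).
    have -> : X j.+1 i - X j i = - ((x' i - x i) / K%:R).
      by rewrite /X -natr1; field; rewrite gt_eqF.
    by rewrite normrN normrM [`|K%:R^-1|]gtr0_norm ?invr_gt0 // mul_divK ?gt_eqF.
  rewrite -(ler_pM2l KR); apply: le_trans ht.
  have -> : T j.+1 - (T j - theta * l `^ p) =
      - ((t' - t - K%:R * (theta * l `^ p)) / K%:R).
    by rewrite /T -natr1; field; rewrite gt_eqF.
  by rewrite normrN normrM [`|K%:R^-1|]gtr0_norm ?invr_gt0 // mul_divK ?gt_eqF.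
have := chain K.
have -> : X K = x by apply/funext => i; rewrite /X divff ?gt_eqF // mul1r subKr.
by have -> : T K = t by rewrite /T divff ?gt_eqF // mul1r subKr.
Qed.

End Chains.

(** * From a dyadic cell to the shifted rectangle *)

Section Assembly.
Variables (R : realType) (n d : nat) (p : R).
Hypotheses (n_gt0 : (0 < n)%N) (d_gt0 : (0 < d)%N) (p_gt1 : 1 < p).
Hypothesis dp_ge : ln 9 / ln 2 <= d%:R * p.
Implicit Types (P Q : prect R n) (E : set (spacetime R n)).

Lemma bernoulli_sub (eta : R) m : 0 <= eta <= 1 -> 1 - m%:R * eta <= (1 - eta) ^+ m.
Proof.
move=> /andP[e0 e1]; elim: m => [|m IH]; first by rewrite mul0r subr0 expr0.
have m0 : 0 <= m%:R :> R by [].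
have h : (1 - eta) * (1 - m%:R * eta) <= (1 - eta) ^+ m.+1.
  by rewrite exprS ler_wpM2l // subr_ge0.
by apply: le_trans h; rewrite -natr1; nra.
Qed.

(** The base is the ratio r of the side of R to the side of a chain cube: m + 1 subdivisions lead
    from R to a cell, and chain cubes have half the side of the cell. *)
Lemma scale_exists (e M : R) : 0 < e -> 0 < M ->
  exists m, M <= e * (2 * (2 ^+ d) ^+ m.+1) `^ (p - 1).
Proof.
move=> e0 M0; have p1 : 0 < p - 1 by rewrite subr_gt0.
have Me0 : 0 <= M / e by rewrite divr_ge0 // ltW.
have [m hm] : exists m : nat, (M / e) `^ (p - 1)^-1 < 2 ^+ m.
  by exists (Num.bound ((M / e) `^ (p - 1)^-1)); apply: upper_nthrootP.
exists m; rewrite mulrC -ler_pdivrMr //.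
have -> : M / e = ((M / e) `^ (p - 1)^-1) `^ (p - 1).
  by rewrite -powRrM mulVf ?gt_eqF // powRr1.
have d2 : 2 <= 2 ^+ d :> R by rewrite -[leLHS]expr1 ler_weXn2l // ler1n.
have h1 : 2 ^+ m <= (2 ^+ d) ^+ m :> R by rewrite lerXn2r ?nnegrE ?exprn_ge0.
have h0 : 0 <= (2 ^+ d) ^+ m :> R by rewrite !exprn_ge0.
have h2 : 0 <= 2 * (2 ^+ d) ^+ m.+1 :> R by rewrite mulr_ge0 ?exprn_ge0.
rewrite ge0_ler_powR ?nnegrE ?powR_ge0 ?(ltW p1) //.
by apply: le_trans (ltW hm) _; rewrite exprS; nra.
Qed.

(** Here v = l^p, rho = r^(p-1), tp = 2^p and [D] is the time to travel. Take for [K] the integer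
    part of D/(theta v): the remainder is below theta v, which K >= theta/eta absorbs into the
    tolerance. The assumption on [rho] makes [K] large enough for this and for the distance in
    space. *)
Lemma step_count (theta theta1 eta r rho tp v B D : R) :
  1 < theta -> 0 < eta -> 2 <= r -> 0 < tp -> 0 < v -> 0 <= B ->
  (1 + theta) / eta + tp + 1 <= (theta1 - 1) / (2 * theta) * rho ->
  ((theta1 - 1) / 2 * (r * rho) - theta * tp) * v <= D -> D <= B * v ->
  exists K : nat, [/\ (0 < K)%N, r <= K%:R * eta,
    `|D - K%:R * (theta * v)| <= K%:R * (eta * v) & (K <= Num.bound B)%N].
Proof.
move=> th1 eta0 r2 tp0 v0 B0 hM hD1 hD2.
have th0 : 0 < theta by lra.
have tv0 : 0 < theta * v by rewrite mulr_gt0.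
have r0 : 0 < r by lra.
have lo : r / eta + theta / eta + 1 <= D / (theta * v).
  rewrite ler_pdivlMr //; apply: le_trans hD1.
  rewrite [leLHS]mulrA ler_pM2r //.
  have -> : (theta1 - 1) / 2 * (r * rho) - theta * tp =
    ((theta1 - 1) / (2 * theta) * rho * r - tp) * theta by field; lra.
  rewrite ler_pM2r //.
  have h1 : ((1 + theta) / eta + tp + 1) * r <=
      (theta1 - 1) / (2 * theta) * rho * r by rewrite ler_pM2r.
  have eta_inv : 0 < eta^-1 by rewrite invr_gt0.
  have h2 : theta / eta <= theta / eta * r.
    by rewrite ler_peMr ?divr_ge0 //; lra.
  have h3 : (tp + 1) * 1 <= (tp + 1) * r by rewrite ler_pM2l; lra.
  lra.
have re0 : 0 < r / eta by rewrite divr_gt0.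
have te0 : 0 < theta / eta by rewrite divr_gt0.
have u0 : 0 <= D / (theta * v) by lra.
have /andP[] := truncn_itv u0; set K := Num.truncn _.
rewrite -natr1 => hK1 hK2.
have K1 : r / eta <= K%:R by lra.
have K2 : theta / eta <= K%:R by lra.
exists K; split.
- by rewrite -(ltr_nat R); apply: lt_le_trans K1.
- by rewrite -ler_pdivrMr.
- move: hK1 hK2; rewrite ler_pdivlMr // ltr_pdivrMr // => hK1 hK2.
  rewrite ger0_norm ?subr_ge0 //; apply: (@le_trans _ _ (theta * v)); first lra.
  by rewrite mulrA ler_pM2r // -ler_pdivrMr.
rewrite -(ler_nat R); apply: le_trans hK1 _.
apply: le_trans (ltW (archi_boundP B0)); rewrite ler_pdivrMr //.
apply: le_trans hD2 _; rewrite ler_wpM2l // ler_peMl //; lra.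
Qed.

Lemma good_family_le (c : R) (A B : \bar R) E P : (A <= B)%E ->
  good_family d p c B E P -> good_family d p c A E P.
Proof.
move=> AB [N [S [h1 h2 h3]]]; exists N, S; split => // i.
exact: le_trans AB (h2 i).
Qed.

(** Sides shrink by delta^K along the chain, volumes by delta^(K(n+p)), and the last use of porosity
    costs one more [delta]; [b] gathers the factors of the side bound free of [delta]. *)
Lemma good_family_weight (r c delta : R) (K : nat) (s : R) E P (A : prect R n) :
  0 < delta -> 0 < r -> 0 < s -> is_prect A ->
  (delta / 16 / 2 ^+ d) ^+ K * (plx A / r) <= s ->
  let b := (1 / 16 / 2 ^+ d) ^+ K / r / 2 / 2 ^+ d in
  let q := s / 2 / 2 ^+ d in
  good_family d p c (delta / 2 * (q ^+ n * q `^ p))%:E E P ->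
  good_family d p c ((b ^+ n * b `^ p / 2 *
     delta `^ (1 + K%:R * n%:R + K%:R * p))%:E * pmeas p A)%E E P.
Proof.
move=> de0 r0 s0 hA hs b q; apply: good_family_le.
rewrite pmeasE // -EFinM lee_fin.
have a0 := plx_gt0 hA; set a := plx A in hs a0 *.
have D0 : 0 < delta ^+ K by rewrite exprn_gt0.
have d0 : 0 < 2 ^+ d :> R by rewrite exprn_gt0.
have b0 : 0 < b by rewrite !divr_gt0 ?exprn_gt0 ?divr_gt0 ?exprn_gt0.
have hq : delta ^+ K * b * a <= q.
  have -> : delta ^+ K * b * a = (delta / 16 / 2 ^+ d) ^+ K * (a / r) / 2 / 2 ^+ d.
    by rewrite /b !expr_div_n expr1n; field; rewrite !gt_eqF.
  by rewrite /q !ler_pM2r ?invr_gt0.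
clearbody b q.
have Dba0 : 0 <= delta ^+ K * b * a by rewrite !mulr_ge0 ?(ltW D0) ?(ltW b0) ?(ltW a0).
have q0 : 0 <= q := le_trans Dba0 hq.
have -> : delta `^ (1 + K%:R * n%:R + K%:R * p) =
    delta * ((delta ^+ K) ^+ n * (delta ^+ K) `^ p).
  rewrite !powRD ?(gt_eqF de0) ?implybT // powRr1 ?(ltW de0) // -mulrA.
  by rewrite !powRrM !powR_mulrn ?exprn_ge0 ?(ltW de0).
have h1 : (delta ^+ K * b * a) ^+ n <= q ^+ n by rewrite lerXn2r.
have h2 : (delta ^+ K * b * a) `^ p <= q `^ p.
  by rewrite ge0_ler_powR ?nnegrE // (le_trans ler01) // ltW.
have h3 : (delta ^+ K * b * a) ^+ n * (delta ^+ K * b * a) `^ p <= q ^+ n * q `^ p.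
  by apply: ler_pM; rewrite ?exprn_ge0 ?powR_ge0.
apply: (@le_trans _ _ (delta / 2 *
    ((delta ^+ K * b * a) ^+ n * (delta ^+ K * b * a) `^ p))); last first.
  by rewrite ler_pM2l ?divr_gt0.
rewrite !exprMn !powRM ?mulr_ge0 ?(ltW D0) ?(ltW b0) ?(ltW a0) //.
have /andP[_ ht] := plt_bounds p hA; rewrite -/a in ht.
set D1 := (delta ^+ K) ^+ n; set D2 := (delta ^+ K) `^ p.
set b1 := b ^+ n; set b2 := b `^ p; set a1 := a ^+ n; set a2 := a `^ p in ht *.
have -> : b1 * b2 / 2 * (delta * (D1 * D2)) * (a1 * plt p A) =
   delta / 2 * (D1 * b1 * a1 * (D2 * b2)) * plt p A by lra.
have -> : delta / 2 * (D1 * b1 * a1 * (D2 * b2 * a2)) =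
   delta / 2 * (D1 * b1 * a1 * (D2 * b2)) * a2 by lra.
rewrite ler_wpM2l // !mulr_ge0 ?invr_ge0 ?(ltW de0) // ?exprn_ge0 ?powR_ge0 // ltW //.
Qed.

Lemma good_family0 (c delta theta : R) E P :
  weakly_porous p d c delta theta E -> is_prect P -> good_family d p c 0%E E P.
Proof.
move=> [_ _ _ _ por] hP; have [N [S [hS _ hc]]] := por P hP.
exists N, S; split => // i.
have hSi : is_prect (S i) by case: hS => h _ _; exact: (dyadic_prect dp_ge hP (h i)).
rewrite pmeasE // lee_fin mulr_ge0 ?exprn_ge0 //; first exact/ltW/plx_gt0.
exact/ltW/plt_gt0.
Qed.

(** The shortest trip has the cell at the top of R and the target at the bottom of the shifted
    rectangle, the longest one the reverse. The halves come from the truncation of R, and w v stands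
    for L^p. *)
Lemma displacement_bounds (theta theta1 theta2 psi tau tauQ tA b0 bQ bA w tp v : R) :
  1 < theta -> 1 < theta1 -> theta1 <= psi <= theta2 -> 0 < w * v ->
  w * v / 2 <= tau <= w * v -> 0 < tauQ <= tp * v -> 0 < tA ->
  b0 <= bQ /\ bQ + tauQ <= b0 + tau ->
  b0 + psi * tau <= bA /\ bA + tA <= b0 + psi * tau + tau ->
  ((theta1 - 1) / 2 * w - theta * tp) * v <= bA - (bQ + theta * tauQ) <=
    (theta2 + 1) * w * v.
Proof.
move=> th1 t11 /andP[ps1 ps2] wv /andP[tau1 tau2] /andP[tq0 tq1] tA0 [q1 q2] [a1 a2].
have tau0 : 0 <= tau by lra.
have h1 : (theta1 - 1) * (w * v / 2) <= (psi - 1) * tau by apply: ler_pM; lra.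
have h2 : theta * tauQ <= theta * (tp * v) by rewrite ler_pM2l //; lra.
have h3 : (psi + 1) * tau <= (theta2 + 1) * (w * v) by apply: ler_pM; lra.
have h4 : 0 <= theta * tauQ by rewrite mulr_ge0 //; lra.
by apply/andP; split; lra.
Qed.

Lemma dist_le_side (a L x l x' l' : R) : 0 < l -> 0 < l' ->
  a <= x /\ x + l <= a + L -> a <= x' /\ x' + l' <= a + L -> `|x' - x| <= L.
Proof. by move=> l0 l0' [h1 h2] [h3 h4]; rewrite ler_norml; apply/andP; split; lra. Qed.

Lemma dyadic_corners P Q : is_prect P -> dyadic p d P Q ->
  [/\ forall i, pleft P i <= pleft Q i /\ pleft Q i + plx Q <= pleft P i + plx P,
      pbottom p P <= pbottom p Q /\
        pbottom p Q + plt p Q <= pbottom p P + plt p P &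
      plx Q <= plx P].
Proof.
move=> hP dQ; have hQ := dyadic_prect dp_ge hP dQ.
have := dyadic_sub dp_ge hP dQ; rewrite !prect_setE.
move=> /(rbox_sub (plx_gt0 hQ) (plt_gt0 p hQ)) [hx ht]; split => //.
by have [? ?] := hx (Ordinal n_gt0); lra.
Qed.

(** Half the side suffices despite truncation: since p > 1, halving the side at least halves the
    time length of the cube. *)
Lemma corner_cube_sub P (l : R) : is_prect P -> 0 < l -> l <= plx P / 2 ->
  rbox (pleft P) (pbottom p P) l (l `^ p) `<=` prect_set p P.
Proof.
move=> hP l0 lP; have x0 := plx_gt0 hP; rewrite prect_setE.
apply: rbox_subset => // [i|]; first by split; rewrite ?lerD2l //; lra.
rewrite lerD2l; apply: le_trans (powR_half_le p_gt1 x0 (ltW l0) lP) _.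
by have /andP[] := plt_bounds p hP.
Qed.

Lemma good_family_grandchild (c delta theta c0 eta psi theta1 theta2 r : R) (m K : nat)
    E P0 P Q A :
  r = 2 * (2 ^+ d) ^+ m.+1 ->
  K = Num.bound ((theta2 + 1) * (r * r `^ (p - 1))) ->
  weakly_porous p d c delta theta E -> 0 < c0 -> c0 <= c ->
  0 < eta <= 1 -> 1 - c0 / 2 <= (1 - eta) ^+ n.+1 ->
  1 < theta -> 1 < theta1 -> theta1 <= psi <= theta2 ->
  (1 + theta) / eta + 2 `^ p + 1 <= (theta1 - 1) / (2 * theta) * r `^ (p - 1) ->
  is_prect P0 -> dyadic1 p d P0 P -> dyadic_gen p d m P Q ->
  dyadic p d (pshift p psi P0) A -> set_free E (prect_set p A) ->
  let b := (1 / 16 / 2 ^+ d) ^+ K / r / 2 / 2 ^+ d in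
  good_family d p c ((b ^+ n * b `^ p / 2 *
     delta `^ (1 + K%:R * n%:R + K%:R * p))%:E * pmeas p A)%E E Q.
Proof.
move=> er eK wp c00 c0c /andP[eta0 eta1] hc th1 t11 ps hM hP0 hP gQ dA fA b.
have hPP := dyadic1_prect dp_ge hP0 hP.
have hQ := gen_prect dp_ge hPP gQ.
have hA := dyadic_prect dp_ge (pshift_prect p psi hP0) dA.
have [_ /andP[de0 de1] _ _ _] := wp.
have d1 : 1 <= 2 ^+ d :> R by rewrite exprn_ege1 // ler1n.
have r2 : 2 <= r by rewrite er ler_peMr // exprn_ege1.
have r0 : 0 < r by exact: lt_le_trans r2.
have lQ0 := plx_gt0 hQ.
have xQ : plx P0 = r * (plx Q / 2).
  rewrite (gen_plx gQ); case: hP => -> _ _; rewrite er exprS.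
  have h : 2 ^+ d != 0 :> R by rewrite expf_neq0 ?pnatr_eq0.
  by field; rewrite ?expf_neq0.
have [l [l0 lQ lP]] : exists l, [/\ 0 < l, plx Q = 2 * l & plx P0 = r * l].
  by exists (plx Q / 2); split; rewrite ?divr_gt0 // mul_divK.
have Lv : plx P0 `^ p = r * r `^ (p - 1) * l `^ p.
  by rewrite lP powRM ?(ltW r0) ?(ltW l0) // mulr_powRB1 ?(ltW r0) // (lt_trans ltr01).
have Qv : plx Q `^ p = 2 `^ p * l `^ p by rewrite lQ powRM ?(ltW l0).
have v0 := powR_gt0 p l0; have w0 : 0 < r * r `^ (p - 1) by rewrite mulr_gt0 ?powR_gt0.
have dQ : dyadic p d P0 Q by apply: dyadic1_trans hP _; exists m.
have [Qx Qt _] := dyadic_corners hP0 dQ.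
have [Ax At aL] := dyadic_corners (pshift_prect p psi hP0) dA.
rewrite pshift_bottom pshift_plt in At.
have a0 := plx_gt0 hA.
have /andP[D1 D2] : ((theta1 - 1) / 2 * (r * r `^ (p - 1)) - theta * 2 `^ p) * l `^ p
    <= pbottom p A - (pbottom p Q + theta * plt p Q) <=
    (theta2 + 1) * (r * r `^ (p - 1)) * l `^ p.
  apply: (displacement_bounds th1 t11 ps _ _ _ (plt_gt0 p hA) Qt At).
  - by rewrite mulr_gt0.
  - by rewrite -Lv plt_bounds.
  - by rewrite plt_gt0 // -Qv; have /andP[] := plt_bounds p hQ.
have B0 : 0 <= (theta2 + 1) * (r * r `^ (p - 1)).
  apply: mulr_ge0 (ltW w0); case/andP: ps => ps1 ps2.
  by rewrite addr_ge0 // (le_trans _ (le_trans ps1 ps2)) // (le_trans ler01) // ltW.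
have [k [k0 kr kt kK]] :=
  step_count th1 eta0 r2 (powR_gt0 p (ltr0Sn _ 1)) v0 B0 hM D1 D2.
have s0 : 0 < plx A / r by rewrite divr_gt0.
(* [A] may be larger or smaller than a chain cube. Dividing its side by [r] fits both: A is no wider
   than R, whose side is r l, and r >= 2. *)
have target : free_cube p E (pleft A) (pbottom p A) l (plx A / r).
  have sl : plx A / r <= l by rewrite ler_pdivrMr // mulrC -lP.
  have sa : plx A / r <= plx A / 2 by rewrite ler_pM2l // lef_pV2 ?posrE.
  exists (pleft A), (pbottom p A); split.
    apply: rbox_subset => // [i|]; first by split; rewrite ?lerD2l.
    rewrite lerD2l ge0_ler_powR ?nnegrE ?(ltW s0) ?(ltW l0) //.
    by rewrite (le_trans ler01) // ltW.
  exact: set_free_sub (corner_cube_sub hA s0 sa) fA.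
have eta01 : 0 <= eta <= 1 by rewrite (ltW eta0).
have hx i : `|pleft A i - pleft Q i| <= k%:R * (eta * l).
  apply: le_trans (dist_le_side lQ0 a0 (Qx i) (Ax i)) _.
  by rewrite lP mulrA ler_pM2r.
(* The chain ends at the lower corner of the [theta]-shift of [Q], not of [Q], since porosity is
   still to be applied to [Q]. *)
have [y [u [sub fr]]] := free_cube_chain n_gt0 d_gt0 p_gt1 dp_ge wp c00 c0c eta01 hc
  l0 s0 k0 hx kt target.
have kap0 : 0 < delta / 16 / 2 ^+ d by rewrite !divr_gt0 ?exprn_gt0.
have kap1 : delta / 16 / 2 ^+ d <= 1.
  rewrite !ler_pdivrMr ?exprn_gt0 // mul1r (le_trans (ltW de1)) //.
  by rewrite -[leLHS]mul1r ler_pM // ler1n.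
have sk0 : 0 < (delta / 16 / 2 ^+ d) ^+ k * (plx A / r) by rewrite mulr_gt0 ?exprn_gt0.
(* The number of steps [k] varies with [Q] and [A]; as each step multiplies by at most 1, the
   uniform bound [K] may replace it. *)
apply: (good_family_weight de0 r0 sk0 hA).
  by rewrite eK ler_pM2r // ler_wiXn2l // ltW.
apply: (porous_good_family n_gt0 d_gt0 p_gt1 dp_ge wp hQ sk0).
exists y, u; split => //; apply: subset_trans sub _.
have lQ2 : l <= plx (pshift p theta Q) / 2 by rewrite /= lQ mulrAC divff ?mul1r.
have := corner_cube_sub (pshift_prect p theta hQ) l0 lQ2.
by rewrite pshift_bottom pleft_shift.
Qed.

Lemma chain_factor_bounds (r : R) (K : nat) : 2 <= r ->
  0 < (1 / 16 / 2 ^+ d) ^+ K / r / 2 / 2 ^+ d <= 1.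
Proof.
move=> r2; have r0 : 0 < r by exact: lt_le_trans r2.
have d0 : 0 < 2 ^+ d :> R by rewrite exprn_gt0.
have d1 : 1 <= 2 ^+ d :> R by rewrite exprn_ege1 // ler1n.
have inv1 (x : R) : 1 <= x -> 0 <= x^-1 <= 1.
  by move=> x1; rewrite invr_ge0 (le_trans ler01) //= invf_le1 // (lt_le_trans ltr01).
have /andP[di0 di1] := inv1 _ d1.
have /andP[ri0 ri1] := inv1 r (le_trans (ler1n _ 2) r2).
have /andP[i20 i21] := inv1 2 (ler1n _ 2).
have /andP[i30 i31] := inv1 16 (ler1n _ 16).
have k0 : 0 <= 1 / 16 / 2 ^+ d :> R by rewrite mul1r mulr_ge0.
have k1 : 1 / 16 / 2 ^+ d <= 1 :> R by rewrite mul1r mulr_ile1.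
apply/andP; split; first by rewrite !divr_gt0 ?exprn_gt0 ?divr_gt0.
by rewrite !mulr_ile1 ?mulr_ge0 ?exprn_ge0 ?exprn_ile1.
Qed.

End Assembly.

Theorem theorem5p1 (R : realType) (n d : nat) (p : R)
    (hn : (1 <= n)%N) (hd : (1 <= d)%N) (hp : 1 < p)
    (hdp : ln 9 / ln 2 <= d%:R * p) :
  (forall (c delta theta : R) (E : set (spacetime R n)),
     1 < theta -> weakly_porous p d c delta theta E ->
     forall psi : R, 1 < psi ->
     exists sigma : R, 0 < sigma < 1 /\ dyadic_child_porous p d c sigma psi E)
  /\
  (forall c0 theta theta1 theta2 : R,
     0 < c0 < 1 -> 1 < theta -> 1 < theta1 -> theta1 <= theta2 ->
     exists C nu : R, [/\ 0 < C, 0 < nu &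
       forall (c delta psi : R) (E : set (spacetime R n)),
         weakly_porous p d c delta theta E ->
         c0 <= c -> theta1 <= psi <= theta2 ->
         0 < C * delta `^ nu < 1
         /\ dyadic_child_porous p d c (C * delta `^ nu) psi E]).
Proof.
(* The quantitative half implies the qualitative one, with [c] as its own lower bound and the
   interval of shifts reduced to [psi]. *)
match goal with |- ?A /\ ?B => suff H : B end.
  split => // c delta theta E th1 wp psi ps1.
  have [c01 _ _ _ _] := wp.
  have [C [nu [_ _ hC]]] := H c theta psi psi c01 th1 ps1 (lexx psi).
  exists (C * delta `^ nu); apply: hC => //; by rewrite !lexx.
move=> c0 theta theta1 theta2 /andP[c00 c01] th1 t11 t12.
(* Chosen so that Bernoulli's inequality gives (1 - eta)^(n+1) >= 1 - c0/2. *)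
pose eta := c0 / (2 * n.+1%:R).
have n1 : 1 <= n.+1%:R :> R by rewrite ler1n.
have eta0 : 0 < eta by rewrite divr_gt0 // mulr_gt0 //; lra.
have eta1 : eta <= 1 by rewrite ler_pdivrMr; lra.
have hc : 1 - c0 / 2 <= (1 - eta) ^+ n.+1.
  have := @bernoulli_sub R eta n.+1; rewrite (ltW eta0) eta1 => /(_ isT).
  have -> : n.+1%:R * eta = c0 / 2 by rewrite /eta; field; lra.
  by [].
have tp0 : 0 < 2 `^ p :> R by rewrite powR_gt0.
have e0 : 0 < (theta1 - 1) / (2 * theta) by rewrite divr_gt0; lra.
have M0 : 0 < (1 + theta) / eta + 2 `^ p + 1.
  by rewrite !addr_gt0 // divr_gt0 //; lra.
have [m hm] := scale_exists hd hp e0 M0.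
have [r er] : exists r : R, r = 2 * (2 ^+ d) ^+ m.+1 by exists (2 * (2 ^+ d) ^+ m.+1).
rewrite -er in hm.
have r2 : 2 <= r by rewrite er ler_peMr // !exprn_ege1 // ler1n.
have [K eK] : exists K, K = Num.bound ((theta2 + 1) * (r * r `^ (p - 1))).
  by exists (Num.bound ((theta2 + 1) * (r * r `^ (p - 1)))).
have := chain_factor_bounds d K r2.
set b := _ / _ / _ / _ => /andP[b0 b1].
have bn : b ^+ n <= 1 by rewrite exprn_ile1 // ltW.
have bp : b `^ p <= 1.
  by apply: (le_trans _ b1); apply: ge1r_powR; [rewrite b0 | exact: ltW].
have bn0 : 0 < b ^+ n by rewrite exprn_gt0.
have bp0 : 0 < b `^ p by rewrite powR_gt0.
pose nu : R := 1 + K%:R * n%:R + K%:R * p.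
have nu0 : 1 <= nu.
  by rewrite /nu -addrA lerDl addr_ge0 ?mulr_ge0 // (le_trans ler01) // ltW.
exists (b ^+ n * b `^ p / 2), nu; split; first by rewrite divr_gt0 ?mulr_gt0.
  by apply: lt_le_trans nu0.
move=> c delta psi E wp c0c ps; have [_ /andP[de0 de1] _ _ _] := wp.
have dn0 : 0 < delta `^ nu by rewrite powR_gt0.
have dn1 : delta `^ nu <= 1.
  by apply: (@le_trans _ _ delta); [by apply: ge1r_powR; rewrite ?de0 ?(ltW de1) | exact: ltW].
split.
  apply/andP; split; first by rewrite mulr_gt0 // divr_gt0 ?mulr_gt0.
  apply: (@le_lt_trans _ _ (1 * 1 / 2 * 1)); last by lra.
  by rewrite !ler_pM ?mulr_ge0 ?(ltW bn0) ?(ltW bp0) ?(ltW dn0).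
move=> P0 P hP0 hP; change (good_family d p c
  ((b ^+ n * b `^ p / 2 * delta `^ nu)%:E *
   Defs.lebesgue_pt (largest_free p d E (pshift p psi P0)))%E E P).
have hPP := dyadic1_prect hdp hP0 hP.
(* Without a free rectangle in the shifted one the threshold is 0, and porosity of [P] itself is
   enough. *)
have [->|[A [dA fA ->]]] := largest_freeP d p E (pshift p psi P0).
  by rewrite lebesgue_pt0 mule0; exact: (good_family0 hdp wp hPP).
apply: (good_family_gen hdp (m := m) hPP) => Q gQ.
have eta01 : 0 < eta <= 1 by rewrite eta0.
exact: (good_family_grandchild hn hd hp hdp er eK wp c00 c0c eta01 hc
  th1 t11 ps hm hP0 hP gQ dA fA).
Qed.
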